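(* Let $\Omega\subset\mathbb{R}^N$ be an open bounded domain, $j\in\{1,\dots,N\}$, $u_0\in C(\overline{\Omega})$ and $g=u_0|_{\partial\Omega}$. Let $u$ be the viscosity solution of \[ u_t-\lambda_j(D^2u)=0 \text{ in }\Omega\times(0,\infty),\quad u=g\text{ on }\partial\Omega\times(0,\infty),\quad u(\cdot,0)=u_0\text{ in }\Omega, \] and $z$ the viscosity solution of $\lambda_j(D^2z)=0$ in $\Omega$, $z=g$ on $\partial\Omega$. Then there exist constants $\mu>0$ depending only on $\Omega$ and $C>0$ depending on $u_0$ such that \[ \|u(\cdot,t)-z\|_{L^\infty(\Omega)}\le Ce^{-\mu t}\quad\text{for all }t>0. \]
   Context: $\lambda_j(A)$ denotes the $j$-th smallest eigenvalue of a symmetric $N\times N$ matrix $A$ ($\lambda_1\le\dots\le\lambda_N$), equivalently $\lambda_j(A)=\inf_{\dim S=j}\sup_{v\in S,|v|=1}\langle Av,v\rangle$. Solutions are understood in the viscosity sense (continuous up to the boundary, boundary and initial data attained pointwise; test functions touching from below give $\phi_t-\lambda_j(D^2\phi)\ge0$, from above $\le0$, and in the elliptic case $-\lambda_j(D^2\phi)\ge 0$ resp. $\le0$ with sign conventions of $\lambda_j(D^2z)=0$). For $j=1$ (resp. $j=N$) $z$ is the convex (resp. concave) envelope of $g$ in $\Omega$. *)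

(* Defs.v *)
From Stdlib Require Import Reals ClassicalEpsilon.
From mathcomp Require Import ssreflect ssrfun ssrbool eqtype ssrnat seq fintype bigop.
Set Implicit Arguments. Unset Strict Implicit. Unset Printing Implicit Defensive.

Local Open Scope R_scope.

Definition vec (N : nat) := 'I_N -> R.
Definition mat (N : nat) := 'I_N -> 'I_N -> R.

Definition sumR (n : nat) (f : 'I_n -> R) : R := \big[Rplus/0]_(i < n) f i.

Definition ebasis (N : nat) (i : 'I_N) : vec N := fun k => if k == i then 1 else 0.

Definition near (N : nat) (x : vec N) (r : R) (y : vec N) : Prop :=
  forall k, Rabs (y k - x k) < r.

Definition is_open (N : nat) (S : vec N -> Prop) : Prop :=
  forall x, S x -> exists r, 0 < r /\ forall y, near x r y -> S y.
Definition is_bounded (N : nat) (S : vec N -> Prop) : Prop :=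
  exists M, forall x, S x -> forall k, Rabs (x k) <= M.
Definition is_connected (N : nat) (S : vec N -> Prop) : Prop :=
  ~ exists A B : vec N -> Prop, is_open A /\ is_open B /\
      (forall x, S x -> A x \/ B x) /\ (forall x, S x -> ~ (A x /\ B x)) /\
      (exists x, S x /\ A x) /\ (exists x, S x /\ B x).
Definition is_bounded_domain (N : nat) (S : vec N -> Prop) : Prop :=
  (exists x, S x) /\ is_open S /\ is_connected S /\ is_bounded S.
Definition closure (N : nat) (S : vec N -> Prop) (x : vec N) : Prop :=
  forall r, 0 < r -> exists y, S y /\ near x r y.
Definition boundary (N : nat) (S : vec N -> Prop) (x : vec N) : Prop :=
  closure S x /\ ~ S x.

Definition cont_on (N : nat) (S : vec N -> Prop) (f : vec N -> R) : Prop :=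
  forall x, S x -> forall eps, 0 < eps -> exists delta, 0 < delta /\
    forall y, S y -> near x delta y -> Rabs (f y - f x) < eps.
Definition cont_on_cyl (N : nat) (S : vec N -> Prop) (u : vec N -> R -> R) : Prop :=
  forall x t, closure S x -> 0 <= t -> forall eps, 0 < eps -> exists delta, 0 < delta /\
    forall y s, closure S y -> 0 <= s -> near x delta y -> Rabs (s - t) < delta ->
      Rabs (u y s - u x t) < eps.
Definition cont_st (N : nat) (f : vec N -> R -> R) : Prop :=
  forall x t eps, 0 < eps -> exists delta, 0 < delta /\
    forall y s, near x delta y -> Rabs (s - t) < delta -> Rabs (f y s - f x t) < eps.
Definition cont_x (N : nat) (f : vec N -> R) : Prop :=
  forall x eps, 0 < eps -> exists delta, 0 < delta /\
    forall y, near x delta y -> Rabs (f y - f x) < eps.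

Definition has_partial (N : nat) (f : vec N -> R) (x : vec N) (i : 'I_N) (l : R) : Prop :=
  derivable_pt_lim (fun s => f (fun k => x k + s * ebasis i k)) 0 l.

Definition is_C21 (N : nat) (phi : vec N -> R -> R) (Dt : vec N -> R -> R)
    (Dx : 'I_N -> vec N -> R -> R) (Dxx : 'I_N -> 'I_N -> vec N -> R -> R) : Prop :=
  (forall x t, derivable_pt_lim (fun s => phi x s) t (Dt x t)) /\
  (forall i x t, has_partial (fun y => phi y t) x i (Dx i x t)) /\
  (forall i k x t, has_partial (fun y => Dx i y t) x k (Dxx i k x t)) /\
  cont_st phi /\ cont_st Dt /\ (forall i, cont_st (Dx i)) /\
  (forall i k, cont_st (Dxx i k)).

Definition is_C2 (N : nat) (psi : vec N -> R) (Dx : 'I_N -> vec N -> R)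
    (Dxx : 'I_N -> 'I_N -> vec N -> R) : Prop :=
  (forall i x, has_partial psi x i (Dx i x)) /\
  (forall i k x, has_partial (Dx i) x k (Dxx i k x)) /\
  cont_x psi /\ (forall i, cont_x (Dx i)) /\ (forall i k, cont_x (Dxx i k)).

(* ---------- j-th eigenvalue via Courant–Fischer ---------- *)
Definition Rsup (E : R -> Prop) : R := epsilon (inhabits 0) (fun l => is_lub E l).
Definition Rinf (E : R -> Prop) : R := - Rsup (fun y => E (- y)).

Definition quad (N : nat) (A : mat N) (v : vec N) : R :=
  sumR (fun i => sumR (fun k => A i k * v i * v k)).
Definition norm2 (N : nat) (v : vec N) : R := sumR (fun i => v i * v i).
Definition lin_comb (N j : nat) (vs : 'I_j -> vec N) (c : 'I_j -> R) : vec N :=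
  fun k => sumR (fun i => c i * vs i k).
Definition lin_indep (N j : nat) (vs : 'I_j -> vec N) : Prop :=
  forall c, (forall k, lin_comb vs c k = 0) -> forall i, c i = 0.
Definition in_span (N j : nat) (vs : 'I_j -> vec N) (v : vec N) : Prop :=
  exists c, v = lin_comb vs c.

Definition lambda (N j : nat) (A : mat N) : R :=
  Rinf (fun m => exists vs : 'I_j -> vec N, lin_indep vs /\
          m = Rsup (fun q => exists v, in_span vs v /\ norm2 v = 1 /\ q = quad A v)).

Definition touch_below (N : nat) (S : vec N -> Prop) (u phi : vec N -> R -> R)
    (x0 : vec N) (t0 : R) : Prop :=
  phi x0 t0 = u x0 t0 /\ exists r, 0 < r /\
    forall y s, S y -> 0 < s -> near x0 r y -> Rabs (s - t0) < r -> phi y s <= u y s.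
Definition touch_above (N : nat) (S : vec N -> Prop) (u phi : vec N -> R -> R)
    (x0 : vec N) (t0 : R) : Prop :=
  phi x0 t0 = u x0 t0 /\ exists r, 0 < r /\
    forall y s, S y -> 0 < s -> near x0 r y -> Rabs (s - t0) < r -> u y s <= phi y s.

Definition parab_visc_sol (N j : nat) (Om : vec N -> Prop) (g u0 : vec N -> R)
    (u : vec N -> R -> R) : Prop :=
  cont_on_cyl Om u /\
  (forall x t, boundary Om x -> 0 < t -> u x t = g x) /\
  (forall x, Om x -> u x 0 = u0 x) /\
  (forall x0 t0, Om x0 -> 0 < t0 -> forall phi Dt Dx Dxx, is_C21 phi Dt Dx Dxx ->
     touch_below Om u phi x0 t0 ->
     Dt x0 t0 - lambda j (fun i k => Dxx i k x0 t0) >= 0) /\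
  (forall x0 t0, Om x0 -> 0 < t0 -> forall phi Dt Dx Dxx, is_C21 phi Dt Dx Dxx ->
     touch_above Om u phi x0 t0 ->
     Dt x0 t0 - lambda j (fun i k => Dxx i k x0 t0) <= 0).

Definition ell_visc_sol (N j : nat) (Om : vec N -> Prop) (g z : vec N -> R) : Prop :=
  cont_on (closure Om) z /\
  (forall x, boundary Om x -> z x = g x) /\
  (forall x0, Om x0 -> forall psi Dx Dxx, is_C2 psi Dx Dxx ->
     psi x0 = z x0 ->
     (exists r, 0 < r /\ forall y, Om y -> near x0 r y -> psi y <= z y) ->
     - lambda j (fun i k => Dxx i k x0) >= 0) /\
  (forall x0, Om x0 -> forall psi Dx Dxx, is_C2 psi Dx Dxx ->
     psi x0 = z x0 ->
     (exists r, 0 < r /\ forall y, Om y -> near x0 r y -> z y <= psi y) ->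
     - lambda j (fun i k => Dxx i k x0) <= 0).

(* Main.v *)
Require Import Defs.
From Stdlib Require Import Reals Lra Lia Classical ClassicalEpsilon FunctionalExtensionality.
From HB Require Import structures.
From mathcomp Require Import ssreflect ssrfun ssrbool eqtype ssrnat seq choice fintype finfun bigop.
From mathcomp Require filter.
Set Implicit Arguments. Unset Strict Implicit. Unset Printing Implicit Defensive.
Local Open Scope R_scope.

(** The bounds follow from a comparison principle for operators [F] of the
    Hessian with [A <= B + c I => F A <= F B + c]; these include [lambda j] and
    [A |-> - lambda j (- A)].  On a time interval of length comparable with the
    squared size of [Om], compare [z] with
    [max_t (u x (s + t) + nu t) - (2M - nu |x|^2)], a strict subsolution of the
    elliptic equation: the gap between [u] and [z] shrinks by a factor 7/8.

    The comparison principle is proved without Alexandrov's theorem.  After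
    sup-convolution one has a semiconvex strict subsolution [u] and a semiconcave
    supersolution [v].  The slopes of the planes touching [u - v] from above
    depend in a Lipschitz way on the contact point, so that counting subcubes
    yields cubes in which the contact points are arbitrarily dense relative to
    the side of the cube.  Blowing up there, [v - u] becomes convex, hence the limit
    of [v] is C^{1,1} and satisfies both the sub- and the supersolution
    inequality.  An extremal argument over all blow-ups of such functions produces
    a quadratic form among them, which is absurd. *)

(** * Limits along an ultrafilter *)

(** Viscosity solutions have no second derivatives at a maximum of their difference, and
    Alexandrov's theorem would supply them only almost everywhere, that is, through measure theory.
    What is needed is weaker: one point near which the slopes of both functions can be followed at
    every scale. Pigeonhole on cubes finds it, and the missing second-order expansion is replaced by
    an algebraic fact on classes of functions stable under zooming and limits. Blow-ups are limits
    at uncountably many points at once, hence the ultrafilter: it makes every bounded sequence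
    converge, without subsequences.

    Comparison is proved for a strict subsolution, because [lambda j] is degenerate: only a shift of
    the Hessian by a multiple of the identity is sure to move it. A paraboloid [nu |x|^2] on the
    bounded set [Om] provides that shift. Its size is tied to a bound [Q] of [|x|^2] on the closure
    of [Om], and so are the time step [5Q/2] and the rate [1/(20Q)]. Hence the rate depends neither
    on the data nor on [j]. *)

Lemma exists_ultrafilter : exists om : (nat -> Prop) -> Prop,
  [/\ forall P Q : nat -> Prop, (forall n, P n -> Q n) -> om P -> om Q,
      forall P Q : nat -> Prop, om P -> om Q -> om (fun n => P n /\ Q n),
      ~ om (fun _ => False),
      forall P : nat -> Prop, om P \/ om (fun n => ~ P n)
    & forall k, om (fun n => (k <= n)%N)].
Proof.
have [G [UG sG]] := filter.ultraFilterLemma filter.eventually_filter.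
have PG := @filter.ultra_proper _ _ UG; have FG := @filter.filter_filter _ _ PG.
exists G; split.
- by move=> P Q PQ; apply: filter.filterS.
- by move=> P Q GP GQ; apply: filter.filterI.
- exact: filter.filter_not_empty.
- by move=> P; apply: filter.in_ultra_setVsetC.
- by move=> k; apply: sG; exists k.
Qed.

(** One free ultrafilter, fixed once for all: [om P] reads as [P n] for most [n]. *)
Definition om : (nat -> Prop) -> Prop :=
  proj1_sig (constructive_indefinite_description _ exists_ultrafilter).

Lemma omP : [/\ forall P Q : nat -> Prop, (forall n, P n -> Q n) -> om P -> om Q,
      forall P Q : nat -> Prop, om P -> om Q -> om (fun n => P n /\ Q n),
      ~ om (fun _ => False),
      forall P : nat -> Prop, om P \/ om (fun n => ~ P n)
    & forall k, om (fun n => (k <= n)%N)].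
Proof. exact: (proj2_sig (constructive_indefinite_description _ exists_ultrafilter)). Qed.

Lemma om_mono (P Q : nat -> Prop) : om P -> (forall n, P n -> Q n) -> om Q.
Proof. by move=> oP PQ; have [H _ _ _ _] := omP; apply: H oP. Qed.

Lemma om_and (P Q : nat -> Prop) : om P -> om Q -> om (fun n => P n /\ Q n).
Proof. by have [_ H _ _ _] := omP; apply: H. Qed.

Lemma om_mono2 (P Q S : nat -> Prop) :
  om P -> om Q -> (forall n, P n -> Q n -> S n) -> om S.
Proof. by move=> oP oQ H; apply: om_mono (om_and oP oQ) _ => n [? ?]; apply: H. Qed.

Lemma om_mono3 (P Q S T : nat -> Prop) :
  om P -> om Q -> om S -> (forall n, P n -> Q n -> S n -> T n) -> om T.
Proof. by move=> oP oQ oS H; apply: om_mono2 (om_and oP oQ) oS _ => n [? ?]; apply: H. Qed.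

Lemma om_ge k : om (fun n => (k <= n)%N).
Proof. by have [_ _ _ _ H] := omP. Qed.

Lemma om_all (P : nat -> Prop) : (forall n, P n) -> om P.
Proof. by move=> H; apply: om_mono (om_ge 0) _. Qed.

Lemma om_ex (P : nat -> Prop) : om P -> exists n, P n.
Proof.
move=> oP; apply: NNPP => nP; have [_ _ H _ _] := omP; apply: H.
by apply: om_mono oP _ => n Pn; apply: nP; exists n.
Qed.

Lemma om_not (P : nat -> Prop) : ~ om P -> om (fun n => ~ P n).
Proof. by have [_ _ _ H _] := omP; case: (H P). Qed.

Lemma om_ord (k : nat) (P : 'I_k -> nat -> Prop) :
  (forall i, om (P i)) -> om (fun n => forall i, P i n).
Proof.
move=> H; apply: NNPP => /om_not nP.
have : exists i, om (fun n => ~ P i n); last first.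
  by move=> [i Hi]; have [n []] := om_ex (om_and (H i) Hi).
suff K (s : seq 'I_k) : om (fun n => exists2 i, i \in s & ~ P i n) ->
    exists i, om (fun n => ~ P i n).
  apply: (K (enum 'I_k)); apply: om_mono nP _ => n /not_all_ex_not [i Hi].
  by exists i => //; rewrite mem_enum.
elim: s => [|a s IH] Hs; first by have [n []] := om_ex Hs.
case: (classic (om (fun n => ~ P a n))) => [|na]; first by exists a.
apply: IH; apply: om_mono2 Hs (H a) _ => n [i]; rewrite inE.
by case: eqVneq => [-> _|_ /= Hi Ki Pa] //; exists i.
Qed.

Definition ucv (a : nat -> R) (l : R) : Prop :=
  forall e, 0 < e -> om (fun n => Rabs (a n - l) < e).

Lemma ucv_eq a b l : om (fun n => a n = b n) -> ucv a l -> ucv b l.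
Proof. by move=> E H e e0; apply: om_mono2 E (H e e0) _ => n ->. Qed.

Lemma ucv_const l : ucv (fun _ => l) l.
Proof. by move=> e e0; apply: om_all => n; rewrite Rminus_diag Rabs_R0. Qed.

Lemma ucv_plus a b l m : ucv a l -> ucv b m -> ucv (fun n => a n + b n) (l + m).
Proof.
move=> Ha Hb e e0; apply: om_mono2 (Ha (e/2) _) (Hb (e/2) _) _; try lra.
by move=> n; split_Rabs; lra.
Qed.

Lemma ucv_opp a l : ucv a l -> ucv (fun n => - a n) (- l).
Proof. by move=> Ha e e0; apply: om_mono (Ha e e0) _ => n; split_Rabs; lra. Qed.

Lemma ucv_minus a b l m : ucv a l -> ucv b m -> ucv (fun n => a n - b n) (l - m).
Proof. by move=> Ha Hb; apply: ucv_plus => //; apply: ucv_opp. Qed.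

Lemma ucv_lt a l c : ucv a l -> l < c -> om (fun n => a n < c).
Proof. by move=> H lc; apply: om_mono (H (c - l) _) _; [lra|move=> n; split_Rabs; lra]. Qed.

Lemma ucv_gt a l c : ucv a l -> c < l -> om (fun n => c < a n).
Proof. by move=> H lc; apply: om_mono (H (l - c) _) _; [lra|move=> n; split_Rabs; lra]. Qed.

Lemma ucv_le a b l m : om (fun n => a n <= b n) -> ucv a l -> ucv b m -> l <= m.
Proof.
move=> H Ha Hb; apply: Rnot_lt_le => ml.
have [n [[? ?] ?]] := om_ex (om_and (om_and (ucv_lt Hb (c := (l+m)/2) ltac:(lra))
   (ucv_gt Ha (c := (l+m)/2) ltac:(lra))) H); lra.
Qed.

Lemma ucv_unique a l m : ucv a l -> ucv a m -> l = m.
Proof.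
have K: om (fun n => a n <= a n) by apply: om_all => n; lra.
by move=> Hl Hm; apply: Rle_antisym; [apply: ucv_le K Hl Hm|apply: ucv_le K Hm Hl].
Qed.

Lemma ucv_squeeze0 a b : om (fun n => Rabs (a n) <= b n) -> ucv b 0 -> ucv a 0.
Proof.
by move=> H Hb e e0; apply: om_mono2 H (Hb e e0) _ => n; split_Rabs; lra.
Qed.

Lemma ucv_exists a K : om (fun n => Rabs (a n) <= K) -> exists l, ucv a l.
Proof.
(* The limit is the supremum of the levels that [a] reaches for most [n]. *)
move=> H; pose E c := om (fun n => c <= a n).
have bE : bound E.
  exists K => c Ec; have [n []] := om_ex (om_and Ec H); split_Rabs; lra.
have nE : exists c, E c.
  by exists (- K); apply: om_mono H _ => n; split_Rabs; lra.
have [l [ub lub]] := completeness E bE nE.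
exists l => e e0.
have H1 : om (fun n => l - e < a n).
  apply: NNPP => /om_not nH.
  have : l <= l - e; last lra.
  apply: lub => c Ec; have [n [? ?]] := om_ex (om_and Ec nH); lra.
have H2 : om (fun n => ~ (l + e/2 <= a n)).
  by apply: om_not => /ub; lra.
by apply: om_mono2 H1 H2 _ => n; split_Rabs; lra.
Qed.

Lemma ucv_bounded a l : ucv a l -> om (fun n => Rabs (a n) <= Rabs l + 1).
Proof. by move=> H; apply: om_mono (H 1 _) _; [lra|move=> n; split_Rabs; lra]. Qed.

Lemma ucv_mult0 a b K : om (fun n => Rabs (a n) <= K) -> ucv b 0 ->
  ucv (fun n => a n * b n) 0.
Proof.
move=> Ha Hb e e0.
have K0 : 0 <= K by have [n] := om_ex Ha; have := Rabs_pos (a n); lra.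
apply: om_mono2 Ha (Hb (e / (K + 1)) _) _; first by apply: Rdiv_lt_0_compat; lra.
move=> n H1; rewrite !Rminus_0_r Rabs_mult => H2.
have -> : e = (K + 1) * (e / (K + 1)) by field; lra.
have := Rabs_pos (a n); have := Rabs_pos (b n); nra.
Qed.

Lemma ucv_mult a b l m : ucv a l -> ucv b m -> ucv (fun n => a n * b n) (l * m).
Proof.
move=> Ha Hb.
have A0 : ucv (fun n => b n * (a n - l)) 0.
  apply: (ucv_mult0 (ucv_bounded Hb)); rewrite -(Rminus_diag l).
  exact: ucv_minus Ha (ucv_const l).
have B0 : ucv (fun n => l * (b n - m)) 0.
  apply: (ucv_mult0 (K := Rabs l)); first by apply: om_all => n; lra.
  rewrite -(Rminus_diag m); exact: ucv_minus Hb (ucv_const m).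
have := ucv_plus (ucv_plus A0 B0) (ucv_const (l * m)).
rewrite !Rplus_0_l; apply: ucv_eq; apply: om_all => n; ring.
Qed.

Lemma ucv_scal c a l : ucv a l -> ucv (fun n => c * a n) (c * l).
Proof. exact: ucv_mult (ucv_const c). Qed.

Lemma ucv_inv : ucv (fun n => / (INR n + 1)) 0.
Proof.
move=> e e0.
have [k [ke /lt_0_INR k0]] := archimed_cor1 e e0.
apply: om_mono (om_ge k) _ => n /leP /le_INR kn.
rewrite Rminus_0_r Rabs_pos_eq; last by left; apply: Rinv_0_lt_compat; lra.
by apply: Rlt_trans ke; apply: Rinv_lt_contravar; nra.
Qed.

(** * Vectors and quadratic forms *)

(** These instances let the generic lemmas on iterated operations act on [sumR]. *)
HB.instance Definition _ := Monoid.isComLaw.Build R 0 Rplus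
  (fun x y z => esym (Rplus_assoc x y z)) Rplus_comm Rplus_0_l.
HB.instance Definition _ := Monoid.isMulLaw.Build R 0 Rmult Rmult_0_l Rmult_0_r.
HB.instance Definition _ := Monoid.isAddLaw.Build R Rmult Rplus
  Rmult_plus_distr_r Rmult_plus_distr_l.

Section Sums.
Variable n : nat.
Implicit Types f g : 'I_n -> R.

Lemma sumR_ext f g : (forall i, f i = g i) -> sumR f = sumR g.
Proof. by move=> H; apply: eq_bigr => i _; apply: H. Qed.

Lemma sumR_plus f g : sumR (fun i => f i + g i) = sumR f + sumR g.
Proof. exact: big_split. Qed.

Lemma sumR_scal c f : sumR (fun i => c * f i) = c * sumR f.
Proof. by rewrite /sumR big_distrr. Qed.

Lemma sumR_ge0 f : (forall i, 0 <= f i) -> 0 <= sumR f.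
Proof.
by move=> H; apply: (big_ind (fun x => 0 <= x)) => [|x y|i _]; [lra|exact: Rplus_le_le_0_compat|exact: H].
Qed.

Lemma sumR_le f g : (forall i, f i <= g i) -> sumR f <= sumR g.
Proof.
move=> H; apply: (big_ind2 (fun x y => x <= y)) => [|x1 x2 y1 y2|i _]; [lra|exact: Rplus_le_compat|exact: H].
Qed.

Lemma sumR_term f i : (forall i, 0 <= f i) -> f i <= sumR f.
Proof.
move=> H; rewrite /sumR (bigD1 i) //=.
rewrite -{1}(Rplus_0_r (f i)); apply: Rplus_le_compat_l.
by apply: (big_ind (fun x => 0 <= x)) => [|x y|k _]; [lra|exact: Rplus_le_le_0_compat|exact: H].
Qed.

Lemma sumR_const c : sumR (fun _ : 'I_n => c) = INR n * c.
Proof.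
rewrite /sumR big_const_ord; elim: n => [|k IH]; first by rewrite /=; ring.
by rewrite iterS IH S_INR; ring.
Qed.

Lemma sumR_delta f i : sumR (fun k => f k * ebasis i k) = f i.
Proof.
rewrite /sumR (bigD1 i) //= big1 /ebasis ?eqxx => [|k /negbTE ->]; ring.
Qed.

Lemma ucv_sumR (a : 'I_n -> nat -> R) (l : 'I_n -> R) :
  (forall i, ucv (a i) (l i)) -> ucv (fun m => sumR (fun i => a i m)) (sumR l).
Proof.
move=> H; rewrite /sumR; elim: (index_enum 'I_n) => [|i s IH].
  by rewrite big_nil; apply: ucv_eq (ucv_const 0); apply: om_all => m; rewrite big_nil.
rewrite big_cons; apply: ucv_eq (ucv_plus (H i) IH); apply: om_all => m.
by rewrite big_cons.
Qed.

End Sums.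

Lemma sumR_exchange (m n : nat) (f : 'I_m -> 'I_n -> R) :
  sumR (fun i => sumR (fun k => f i k)) = sumR (fun k => sumR (fun i => f i k)).
Proof. exact: exchange_big. Qed.

Section Vectors.
Variable N : nat.
Implicit Types (x y z p q : vec N) (A B : mat N).

Definition dot x y : R := sumR (fun i => x i * y i).
(** Nearly all linear operations are written with [ray]: sums as [ray x 1 y], multiples as
    [ray (vzero N) t y]. *)
Definition ray x (t : R) y : vec N := fun i => x i + t * y i.
Definition vsub x y : vec N := fun i => x i - y i.
Definition vzero : vec N := fun _ => 0.

Lemma dot_norm2 x : dot x x = norm2 x. Proof. by []. Qed.

Lemma dotC x y : dot x y = dot y x.
Proof. by apply: sumR_ext => i; ring. Qed.

Lemma dot_ray z x t y : dot z (ray x t y) = dot z x + t * dot z y.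
Proof. rewrite /dot -sumR_scal -sumR_plus; apply: sumR_ext => i; rewrite /ray; ring. Qed.

Lemma dot_rayl z x t y : dot (ray x t y) z = dot x z + t * dot y z.
Proof. by rewrite dotC dot_ray !(dotC z). Qed.

Lemma dot_sub z x y : dot z (vsub x y) = dot z x - dot z y.
Proof.
have -> : vsub x y = ray x (-1) y by apply: functional_extensionality => i; rewrite /ray /vsub; ring.
by rewrite dot_ray; ring.
Qed.

Lemma dot_subl z x y : dot (vsub x y) z = dot x z - dot y z.
Proof. by rewrite dotC dot_sub !(dotC z). Qed.

Lemma dot_0r x : dot x vzero = 0.
Proof. rewrite /dot /vzero (sumR_ext (g := fun i => 0 * 0)); [rewrite sumR_scal; ring|by move=> i; ring]. Qed.

Lemma dot_0l x : dot vzero x = 0.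
Proof. by rewrite dotC dot_0r. Qed.

Lemma norm2_ge0 x : 0 <= norm2 x.
Proof. by apply: sumR_ge0 => i; nra. Qed.

Lemma norm2_term x i : x i * x i <= norm2 x.
Proof. by apply: (sumR_term (f := fun i => x i * x i)) => k; nra. Qed.

Lemma norm2_0 : norm2 vzero = 0.
Proof. exact: dot_0r. Qed.

Lemma norm2_eq0 x : norm2 x = 0 -> x = vzero.
Proof.
move=> H; apply: functional_extensionality => i.
by have := norm2_term x i; rewrite H /vzero; nra.
Qed.

Lemma norm2_ray x t y : norm2 (ray x t y) = norm2 x + 2 * t * dot x y + t * t * norm2 y.
Proof. by rewrite -!dot_norm2 dot_ray !dot_rayl (dotC y x); ring. Qed.

Lemma norm2_sub x y : norm2 (vsub x y) = norm2 x - 2 * dot x y + norm2 y.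
Proof. by rewrite -!dot_norm2 dot_sub !dot_subl (dotC y x); ring. Qed.

Lemma norm2_subC x y : norm2 (vsub x y) = norm2 (vsub y x).
Proof. by rewrite !norm2_sub (dotC y x); ring. Qed.

Lemma vsub_self x : vsub x x = vzero.
Proof. by apply: functional_extensionality => i; rewrite /vsub /vzero; ring. Qed.

Lemma young x y : Rabs (2 * dot x y) <= norm2 x + norm2 y.
Proof.
have := norm2_ge0 (vsub x y); have := norm2_ge0 (ray x 1 y).
by rewrite norm2_sub norm2_ray; split_Rabs; lra.
Qed.

Lemma norm2_ray_le x t y : norm2 (ray x t y) <= 2 * norm2 x + 2 * (t * t) * norm2 y.
Proof.
by have := norm2_ge0 (ray x (- t) y); rewrite !norm2_ray; lra.
Qed.

Lemma norm2_sub_le x y : norm2 (vsub x y) <= 2 * norm2 x + 2 * norm2 y.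
Proof. by have := young x y; rewrite norm2_sub; split_Rabs; lra. Qed.

(** The gradient of [quad A]. Matrices are not assumed symmetric, hence the two entries. *)
Definition quadgrad A x : vec N := fun k => sumR (fun i => (A i k + A k i) * x i).

Lemma quad_ray A x t y :
  quad A (ray x t y) = quad A x + t * dot (quadgrad A x) y + t * t * quad A y.
Proof.
have -> : dot (quadgrad A x) y =
    sumR (fun i => sumR (fun k => A i k * x i * y k + A i k * y i * x k)).
  transitivity (sumR (fun k => sumR (fun i => (A i k + A k i) * x i * y k))).
    apply: sumR_ext => k; rewrite Rmult_comm -sumR_scal; apply: sumR_ext => i; ring.
  transitivity (sumR (fun k => sumR (fun i => A i k * x i * y k)) +
                sumR (fun k => sumR (fun i => A k i * y k * x i))).
    rewrite -sumR_plus; apply: sumR_ext => k; rewrite -sumR_plus; apply: sumR_ext => i; ring.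
  rewrite [X in X + _]sumR_exchange -sumR_plus; apply: sumR_ext => k.
  by rewrite -sumR_plus.
rewrite /quad -!sumR_scal -!sumR_plus; apply: sumR_ext => i.
rewrite -!sumR_scal -!sumR_plus; apply: sumR_ext => k; rewrite /ray; ring.
Qed.

Definition madd A B : mat N := fun i k => A i k + B i k.
Definition mscal c : mat N := fun i k => c * ebasis i k.

Lemma quad_madd A B x : quad (madd A B) x = quad A x + quad B x.
Proof.
rewrite /quad -sumR_plus; apply: sumR_ext => i; rewrite -sumR_plus.
by apply: sumR_ext => k; rewrite /madd; ring.
Qed.

Lemma quad_mscal c x : quad (mscal c) x = c * norm2 x.
Proof.
rewrite /quad /norm2 -sumR_scal; apply: sumR_ext => i.
rewrite -(sumR_delta (fun k => c * (x i * x k)) i); apply: sumR_ext => k.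
by rewrite /mscal; ring.
Qed.

Definition mopp A : mat N := fun i k => - A i k.

Lemma quad_mopp A x : quad (mopp A) x = - quad A x.
Proof.
rewrite -(Rmult_1_l (quad A x)) Ropp_mult_distr_l /quad -sumR_scal; apply: sumR_ext => i.
by rewrite -sumR_scal; apply: sumR_ext => k; rewrite /mopp; ring.
Qed.

Lemma quad_bound A : exists K, 0 <= K /\ forall x, Rabs (quad A x) <= K * norm2 x.
Proof.
exists (sumR (fun i => sumR (fun k => Rabs (A i k)))); split.
  by apply: sumR_ge0 => i; apply: sumR_ge0 => k; apply: Rabs_pos.
move=> x.
have T i k : Rabs (A i k * x i * x k) <= norm2 x * Rabs (A i k).
  rewrite Rmult_assoc Rabs_mult (Rmult_comm (norm2 x)).
  apply: Rmult_le_compat_l; first exact: Rabs_pos.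
  have := norm2_term x i; have := norm2_term x k.
  have := Rle_0_sqr (x i - x k); have := Rle_0_sqr (x i + x k); rewrite /Rsqr.
  split_Rabs; nra.
have E : norm2 x * sumR (fun i => sumR (fun k => Rabs (A i k))) =
    sumR (fun i => sumR (fun k => norm2 x * Rabs (A i k))).
  by rewrite -sumR_scal; apply: sumR_ext => i; rewrite -sumR_scal.
rewrite Rmult_comm E; apply: Rabs_le; split.
  rewrite -(Rmult_1_l (sumR _)) Ropp_mult_distr_l -sumR_scal.
  apply: sumR_le => i; rewrite -sumR_scal; apply: sumR_le => k.
  by have := T i k; split_Rabs; lra.
by apply: sumR_le => i; apply: sumR_le => k; have := T i k; split_Rabs; lra.
Qed.

Lemma near_norm2 x r y : 0 < r -> norm2 (vsub y x) < r * r -> near x r y.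
Proof.
move=> r0 H i; have := norm2_term (vsub y x) i; rewrite /vsub in H *.
by split_Rabs; nra.
Qed.

Lemma norm2_box x r : (forall i, Rabs (x i) <= r) -> norm2 x <= INR N * (r * r).
Proof.
move=> H; rewrite -sumR_const; apply: sumR_le => i.
by have := H i; split_Rabs; nra.
Qed.

Definition vcv (X : nat -> vec N) x : Prop := forall i, ucv (fun n => X n i) (x i).

Lemma vcv_const x : vcv (fun _ => x) x.
Proof. by move=> i; apply: ucv_const. Qed.

Lemma vcv_box (X : nat -> vec N) K :
  om (fun n => forall i, Rabs (X n i) <= K) -> exists x, vcv X x.
Proof.
move=> H.
have H1 i : exists l, ucv (fun n => X n i) l.
  by apply: (@ucv_exists _ K); apply: om_mono H _ => n.
exists (fun i => epsilon (inhabits 0) (fun l => ucv (fun n => X n i) l)) => i.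
exact: epsilon_spec (H1 i).
Qed.

Lemma vcv_bounded (X : nat -> vec N) K :
  om (fun n => norm2 (X n) <= K) -> exists x, vcv X x.
Proof.
move=> H; apply: (@vcv_box _ (K + 1)); apply: om_mono H _ => n Hn i.
by have := norm2_term (X n) i; split_Rabs; nra.
Qed.

Lemma ucv_dot X Y x y : vcv X x -> vcv Y y -> ucv (fun n => dot (X n) (Y n)) (dot x y).
Proof. by move=> HX HY; apply: (ucv_sumR (a := fun i n => X n i * Y n i)) => i; apply: ucv_mult. Qed.

Lemma ucv_norm2 X x : vcv X x -> ucv (fun n => norm2 (X n)) (norm2 x).
Proof. by move=> H; apply: ucv_dot. Qed.

Lemma ucv_quad A X x : vcv X x -> ucv (fun n => quad A (X n)) (quad A x).
Proof.
move=> H; apply: (ucv_sumR (a := fun i n => sumR (fun k => A i k * X n i * X n k))) => i.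
apply: (ucv_sumR (a := fun k n => A i k * X n i * X n k)) => k.
by apply: ucv_mult => //; apply: ucv_scal.
Qed.

Lemma vcv_sub X Y x y : vcv X x -> vcv Y y -> vcv (fun n => vsub (X n) (Y n)) (vsub x y).
Proof. by move=> HX HY i; apply: ucv_minus. Qed.

Lemma vcv_ray X Y x y t : vcv X x -> vcv Y y -> vcv (fun n => ray (X n) t (Y n)) (ray x t y).
Proof. by move=> HX HY i; apply: ucv_plus => //; apply: ucv_scal. Qed.

Lemma ucv_dist X x : vcv X x -> ucv (fun n => norm2 (vsub (X n) x)) 0.
Proof.
move=> H; rewrite -norm2_0 -(vsub_self x); apply: ucv_norm2.
by apply: vcv_sub => //; apply: vcv_const.
Qed.

Lemma vcv_dist X x : ucv (fun n => norm2 (vsub (X n) x)) 0 -> vcv X x.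
Proof.
move=> H i e e0; apply: om_mono (H (e * e) _) _; first by nra.
move=> n; have := norm2_term (vsub (X n) x) i; rewrite /vsub Rminus_0_r.
by split_Rabs; nra.
Qed.

Lemma vcv_norm2_bounded X x : vcv X x -> om (fun n => norm2 (X n) <= norm2 x + 1).
Proof. by move=> /ucv_norm2 /ucv_lt H; apply: om_mono (H (norm2 x + 1) _) _ => [|n]; lra. Qed.

Lemma vcv_near X x r : vcv X x -> 0 < r -> om (fun n => near x r (X n)).
Proof. by move=> H r0; apply: om_ord => i; apply: H. Qed.

Lemma vcv_dist2 X Y x : vcv X x -> ucv (fun n => norm2 (vsub (Y n) (X n))) 0 -> vcv Y x.
Proof.
move=> HX H i; have HD : vcv (fun n => vsub (Y n) (X n)) vzero.
  apply: vcv_dist; apply: ucv_eq H; apply: om_all => n; congr norm2.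
  by apply: functional_extensionality => k; rewrite /vsub /vzero; ring.
have := ucv_plus (HX i) (HD i); rewrite /vzero Rplus_0_r.
by apply: ucv_eq; apply: om_all => n; rewrite /vsub; ring.
Qed.

Definition usc_on (S : vec N -> Prop) (f : vec N -> R) x : Prop :=
  forall X, (forall n, S (X n)) -> vcv X x -> forall e, 0 < e -> om (fun n => f (X n) < f x + e).

(** The direct method. Boundedness and closedness are asked only above the level [f x0], so that [S]
    may be the whole space when [f] decays at infinity. *)
Lemma argmax (S : vec N -> Prop) (f : vec N -> R) (x0 : vec N) (K : R) :
  S x0 ->
  (forall x, S x -> f x0 <= f x -> norm2 x <= K) ->
  (forall X x, (forall n, S (X n)) -> om (fun n => f x0 <= f (X n)) -> vcv X x -> S x) ->
  (forall x, S x -> usc_on S f x) ->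
  exists x, S x /\ forall y, S y -> f y <= f x.
Proof.
move=> S0 bd cl us.
(* Used with [c = INR] to exclude an unbounded [f], then with levels increasing to the supremum. *)
have lim (c : nat -> R) : (forall n, exists x, S x /\ f x0 <= f x /\ c n <= f x) ->
    exists x, S x /\ forall e, 0 < e -> om (fun n => c n < f x + e).
  move=> H; pose X n := epsilon (inhabits x0) (fun x => S x /\ f x0 <= f x /\ c n <= f x).
  have HX n : S (X n) /\ f x0 <= f (X n) /\ c n <= f (X n) := epsilon_spec _ _ (H n).
  have [x Hx] : exists x, vcv X x.
    by apply: (@vcv_bounded _ K); apply: om_all => n; have [? [? _]] := HX n; apply: bd.
  have SX n : S (X n) by case: (HX n).
  have Sx : S x by apply: cl Hx => //; apply: om_all => n; have [? [? _]] := HX n.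
  exists x; split=> // e e0; apply: om_mono (us x Sx X SX Hx e e0) _ => n.
  by have [_ [_ ?]] := HX n; lra.
pose E c := exists x, S x /\ c = f x.
have bE : bound E.
  apply: NNPP => nb.
  have [|x [_ H]] := lim INR.
    move=> n; apply: NNPP => nx; apply: nb; exists (Rmax (INR n) (f x0)) => c [x [Sx ->]].
    apply: Rnot_lt_le => Hlt; apply: nx; exists x; split=> //.
    by have := Rmax_l (INR n) (f x0); have := Rmax_r (INR n) (f x0); lra.
  have [k Hk] := INR_unbounded (f x + 1).
  have [n [/leP /le_INR ? ?]] := om_ex (om_and (om_ge k) (H 1 ltac:(lra))); lra.
have [l [ub lub]] := completeness E bE (ex_intro _ _ (ex_intro _ x0 (conj S0 erefl))).
(* Apart from this case, near-maximisers can be taken above the level [f x0], as compactness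
   requires. *)
case: (Req_dec l (f x0)) => [El|nl].
  by exists x0; split=> // y Sy; rewrite -El; apply: ub; exists y.
have l0 : f x0 < l by have := ub (f x0) (ex_intro _ x0 (conj S0 erefl)); lra.
have [|x [Sx H]] := lim (fun n => l - / (INR n + 1)).
  move=> n; apply: NNPP => nx.
  have n0 : 0 < / (INR n + 1) by apply: Rinv_0_lt_compat; have := pos_INR n; lra.
  have : l <= Rmax (l - / (INR n + 1)) (f x0); last by rewrite /Rmax; case: Rle_dec; lra.
  apply: lub => c [x [Sx ->]]; apply: Rnot_lt_le => Hlt; apply: nx; exists x; split=> //.
  by have := Rmax_l (l - / (INR n + 1)) (f x0); have := Rmax_r (l - / (INR n + 1)) (f x0); lra.
exists x; split=> // y Sy; apply: Rle_trans (ub _ (ex_intro _ y (conj Sy erefl))) _.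
apply: Rnot_lt_le => Hlt.
have [n [? ?]] := om_ex (om_and (H ((l - f x)/2) ltac:(lra)) (ucv_lt ucv_inv (c := (l - f x)/2) ltac:(lra))).
by lra.
Qed.

End Vectors.

Arguments vzero : clear implicits.

(** * Zoom-invariant classes of functions contain a quadratic form *)

(** A linear term cannot be dominated by a quadratic one near zero; this is how slopes are
    identified below. *)
Lemma lin_small (c D : R) : (forall t, 0 < t -> t * c <= D * (t * t)) -> c <= 0.
Proof.
move=> H; apply: Rnot_lt_le => c0.
have D1 : 0 < Rabs D + 1 by have := Rabs_pos D; lra.
have t0 : 0 < c / (2 * (Rabs D + 1)) by apply: Rdiv_lt_0_compat; lra.
have := H _ t0; have E : c = 2 * (Rabs D + 1) * (c / (2 * (Rabs D + 1))) by field; lra.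
move: (c / _) t0 E => t t0 ->; have := Rle_abs D; nra.
Qed.

Section Pinned.
Variable N : nat.
Implicit Types (V : vec N -> R) (a y z : vec N) (A : mat N).

(** The second-order blow-up at [a]: it removes an affine function and divides by [r^2], so Hessians
    are kept. *)
Definition zoom V a z (r : R) : vec N -> R :=
  fun y => (V (ray a r y) - V a - r * dot z y) / (r * r).

(** A first-order expansion with quadratic error, so [z] is the gradient at [a]. Holding at every
    [a] with one [K], it expresses C^{1,1} regularity. *)
Definition pinned (K : R) V a z : Prop :=
  forall y, Rabs (V y - V a - dot z (vsub y a)) <= K * norm2 (vsub y a).

Lemma ray_sub a y : ray a 1 (vsub y a) = y.
Proof. by apply: functional_extensionality => i; rewrite /ray /vsub; ring. Qed.

Lemma vsub_ray a t y : vsub (ray a t y) a = ray (vzero N) t y.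
Proof. by apply: functional_extensionality => i; rewrite /ray /vsub /vzero; ring. Qed.

Lemma dot_ray0 a t y : dot a (ray (vzero N) t y) = t * dot a y.
Proof. by rewrite dot_ray dot_0r; ring. Qed.

Lemma norm2_ray0 t y : norm2 (ray (vzero N) t y) = t * t * norm2 y.
Proof. by rewrite norm2_ray norm2_0 dot_0l; ring. Qed.

Lemma dot_ebasis a i : dot a (ebasis i) = a i.
Proof. exact: sumR_delta. Qed.

Lemma norm2_ebasis (i : 'I_N) : norm2 (ebasis i) = 1.
Proof. by rewrite -dot_norm2 dot_ebasis /ebasis eqxx. Qed.

Lemma pinned_slope_bound K V a z i : pinned K V a z ->
  (forall y, Rabs (V y) <= K * norm2 y) -> Rabs (z i) <= K * (3 * norm2 a + 3).
Proof.
move=> pin bd.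
have K0 : 0 <= K by have := bd (ebasis i); rewrite norm2_ebasis; have := Rabs_pos (V (ebasis i)); lra.
have := pin (ray a 1 (ebasis i)); rewrite vsub_ray dot_ray0 norm2_ray0 dot_ebasis norm2_ebasis.
have := bd (ray a 1 (ebasis i)); have := bd a; have := norm2_ray_le a 1 (ebasis i).
by rewrite norm2_ebasis; split_Rabs; nra.
Qed.

Lemma ucv_dot0 (Z E : nat -> vec N) K : om (fun n => forall i, Rabs (Z n i) <= K) ->
  vcv E (vzero N) -> ucv (fun n => dot (Z n) (E n)) 0.
Proof.
move=> HZ HE; have -> : 0 = sumR (fun _ : 'I_N => 0) by rewrite sumR_const; ring.
apply: (ucv_sumR (a := fun i n => Z n i * E n i)) => i.
by apply: (@ucv_mult0 _ _ K) (HE i); apply: om_mono HZ _ => n.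
Qed.

(** Equicontinuity: the affine part vanishes because the slopes are bounded, the error because it is
    quadratic. *)
Lemma pinned_cv (Vn : nat -> vec N -> R) (an zn yn : nat -> vec N) a K D :
  om (fun n => pinned K (Vn n) (an n) (zn n)) -> om (fun n => forall i, Rabs (zn n i) <= D) ->
  vcv an a -> vcv yn a -> ucv (fun n => Vn n (yn n) - Vn n (an n)) 0.
Proof.
move=> pin zb Ha Hy.
have Hd : vcv (fun n => vsub (yn n) (an n)) (vzero N) by rewrite -(vsub_self a); apply: vcv_sub.
have H1 := ucv_dot0 zb Hd.
have H2 : ucv (fun n => Vn n (yn n) - Vn n (an n) - dot (zn n) (vsub (yn n) (an n))) 0.
  apply: (@ucv_squeeze0 _ (fun n => K * norm2 (vsub (yn n) (an n)))).
    by apply: om_mono pin _ => n.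
  by rewrite -(Rmult_0_r K) -(norm2_0 N); apply/ucv_scal/ucv_norm2.
have := ucv_plus H2 H1; rewrite Rplus_0_r.
by apply: ucv_eq; apply: om_all => n; ring.
Qed.

Lemma pointwise_limit (Vn : nat -> vec N -> R) (B : vec N -> R) :
  (forall y, om (fun n => Rabs (Vn n y) <= B y)) ->
  exists V, forall y, ucv (fun n => Vn n y) (V y).
Proof.
move=> H; exists (fun y => epsilon (inhabits 0) (fun l => ucv (fun n => Vn n y) l)) => y.
exact: epsilon_spec (ucv_exists (H y)).
Qed.

Definition mcongr (M : nat) (B : mat M) (P : 'I_M -> 'I_N -> R) : mat N :=
  fun i k => sumR (fun l => sumR (fun l' => B l l' * P l i * P l' k)).

Lemma quad_mcongr (M : nat) (B : mat M) (P : 'I_M -> 'I_N -> R) (x : vec N) :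
  quad B (fun l => sumR (fun i => P l i * x i)) = quad (mcongr B P) x.
Proof.
transitivity (sumR (fun l => sumR (fun l' => sumR (fun i => sumR (fun k =>
    B l l' * P l i * P l' k * x i * x k))))).
  apply: sumR_ext => l; apply: sumR_ext => l'.
  rewrite (Rmult_comm _ (sumR (fun i => P l' i * x i))).
  rewrite -sumR_scal Rmult_comm -sumR_scal sumR_exchange; apply: sumR_ext => i.
  rewrite Rmult_comm -sumR_scal; apply: sumR_ext => k.
  by ring.
rewrite /quad (sumR_ext (g := fun l => sumR (fun i => sumR (fun k => sumR (fun l' =>
    B l l' * P l i * P l' k * x i * x k))))); last first.
  move=> l; rewrite sumR_exchange; apply: sumR_ext => i; exact: sumR_exchange.
rewrite sumR_exchange; apply: sumR_ext => i; rewrite sumR_exchange; apply: sumR_ext => k.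
rewrite /mcongr Rmult_assoc Rmult_comm -sumR_scal; apply: sumR_ext => l.
rewrite -sumR_scal; apply: sumR_ext => l'; ring.
Qed.

End Pinned.

(* A maximiser of [V theta / |theta|^2] over the class lies below the paraboloid
   [m |x|^2] and touches it along a segment; zooming at the midpoint turns the
   segment into a line, and a concave function vanishing on a line is invariant
   along it.  This splits off one variable. *)
Lemma quadratic_in_class (n : nat) (C : (vec n -> R) -> Prop) (K : R) :
  (forall V, C V -> forall y, Rabs (V y) <= K * norm2 y) ->
  (forall V a, C V -> exists z, forall r, 0 < r -> C (zoom V a z r)) ->
  (forall (Vn : nat -> vec n -> R) V, (forall k, C (Vn k)) ->
     (forall x, ucv (fun k => Vn k x) (V x)) -> C V) ->
  (exists V, C V) -> exists A : mat n, C (quad A).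
Proof.
elim: n C K => [|n IH] C K CP CZ CL [V0 CV0].
  exists (fun _ _ => 0); suff <- : V0 = quad (fun _ _ => 0) by [].
  apply: functional_extensionality => x.
  have := CP _ CV0 x; rewrite /quad /norm2 /sumR !big_ord0 Rmult_0_r.
  by split_Rabs; lra.
have C0 V : C V -> V (vzero _) = 0.
  by move=> CV; have := CP _ CV (vzero _); rewrite norm2_0 Rmult_0_r; split_Rabs; lra.
(* Both [V] and its zoom are [O(|x|^2)] at the origin, which leaves room only for a zero slope. *)
have slope0 V z : C V -> (forall r, 0 < r -> C (zoom V (vzero _) z r)) -> forall y, dot z y = 0.
  move=> CV Hz; suff H y : dot z y <= 0.
    move=> y; apply: Rle_antisym (H y) _.
    by have := H (ray (vzero _) (-1) y); rewrite dot_ray0; lra.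
  apply: (@lin_small _ (2 * K * norm2 y)) => t t0.
  have := CP _ (Hz 1 ltac:(lra)) (ray (vzero _) t y); rewrite /zoom (C0 _ CV) dot_ray0 norm2_ray0.
  have -> : ray (vzero n.+1) 1 (ray (vzero n.+1) t y) = ray (vzero n.+1) t y.
    by apply: functional_extensionality => i; rewrite /ray /vzero; ring.
  have := CP _ CV (ray (vzero _) t y); rewrite norm2_ray0.
  have -> : forall u, u / (1 * 1) = u by move=> u; field.
  by split_Rabs; lra.
pose E c := exists V th, C V /\ norm2 th = 1 /\ c = V th.
have bE : bound E.
  by exists K => c [V [th [CV [n1 ->]]]]; have := CP _ CV th; rewrite n1; split_Rabs; lra.
have nE : exists c, E c.
  by exists (V0 (ebasis ord0)), V0, (ebasis ord0); split=> //; rewrite norm2_ebasis.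
have [m [ub lub]] := completeness E bE nE.
(* Zooming at the origin by [|x|] brings [x] to the unit sphere, where [m] is the supremum over the
   class. *)
have leM V x : C V -> V x <= m * norm2 x.
  move=> CV; case: (Req_dec (norm2 x) 0) => [x0|x0].
    by have := CP _ CV x; rewrite x0; split_Rabs; lra.
  have xp : 0 < norm2 x by have := norm2_ge0 x; lra.
  have [z Hz] := CZ _ (vzero _) CV; have z0 := slope0 _ _ CV Hz.
  have sp := sqrt_lt_R0 _ xp; have sE := sqrt_sqrt _ (Rlt_le _ _ xp).
  have : zoom V (vzero _) z (sqrt (norm2 x)) (ray (vzero _) (/ sqrt (norm2 x)) x) <= m.
    apply: ub; exists (zoom V (vzero _) z (sqrt (norm2 x))), (ray (vzero _) (/ sqrt (norm2 x)) x).
    split; first exact: Hz.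
    split=> //; rewrite norm2_ray0 -{3}sE; field; lra.
  rewrite /zoom z0 (C0 _ CV) sE.
  have -> : ray (vzero _) (sqrt (norm2 x)) (ray (vzero _) (/ sqrt (norm2 x)) x) = x.
    by apply: functional_extensionality => i; rewrite /ray /vzero; field; lra.
  move=> H; apply: (Rmult_le_reg_r (/ norm2 x)); first exact: Rinv_0_lt_compat.
  have -> : m * norm2 x * / norm2 x = m by field.
  by move: H; rewrite /Rdiv !Rminus_0_r Rmult_0_r Rminus_0_r.
(* Applying [leM] to the zoom at [a] with [r = 1] puts a plane above [V - m |x|^2] touching at [a]:
   this difference is concave. *)
have tangent V a : C V -> exists z, (forall r, 0 < r -> C (zoom V a z r)) /\ forall y,
    V y - m * norm2 y <= V a - m * norm2 a + dot (ray z (- 2 * m) a) (vsub y a).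
  move=> CV; have [z Hz] := CZ _ a CV; exists z; split=> // y.
  have := leM _ (vsub y a) (Hz 1 ltac:(lra)); rewrite /zoom ray_sub dot_rayl.
  have -> : forall u, u / (1 * 1) = u by move=> u; field.
  rewrite norm2_sub dot_sub !dot_sub dot_norm2 (dotC y a); lra.
(* The supremum is attained: maximising pairs have limits, and being pinned at [th] with a common
   [K] transfers the values to the limit point. *)
have [V [th [CV [th1 Vth]]]] : exists V th, C V /\ norm2 th = 1 /\ V th = m.
  have pick k : exists q : (vec n.+1 -> R) * vec n.+1,
      C q.1 /\ norm2 q.2 = 1 /\ m - / (INR k + 1) <= q.1 q.2.
    apply: NNPP => nq; have k0 : 0 < / (INR k + 1) by apply: Rinv_0_lt_compat; have := pos_INR k; lra.
    have : m <= m - / (INR k + 1); last lra.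
    apply: lub => c [V [th [CV [n1 ->]]]]; apply: Rnot_lt_le => Hlt.
    by apply: nq; exists (V, th) => /=; split=> //; split=> //; lra.
  pose q k := epsilon (inhabits (V0, vzero n.+1)) (fun q => C q.1 /\ norm2 q.2 = 1 /\ m - / (INR k + 1) <= q.1 q.2).
  have Hq k : C (q k).1 /\ norm2 (q k).2 = 1 /\ m - / (INR k + 1) <= (q k).1 (q k).2 := epsilon_spec _ _ (pick k).
  have [th Hth] : exists th, vcv (fun k => (q k).2) th.
    by apply: (@vcv_bounded _ _ 1); apply: om_all => k; have [_ [? _]] := Hq k; lra.
  have [V HV] : exists V, forall y, ucv (fun k => (q k).1 y) (V y).
    apply: (@pointwise_limit _ _ (fun y => K * norm2 y)) => y; apply: om_all => k.
    by apply: CP; case: (Hq k).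
  have CV : C V by apply: CL HV => k; case: (Hq k).
  have th1 : norm2 th = 1.
    apply: (ucv_unique (ucv_norm2 Hth)); apply: ucv_eq (ucv_const 1).
    by apply: om_all => k; have [_ [? _]] := Hq k.
  exists V, th; split=> //; split=> //; apply: Rle_antisym.
    by have := leM _ th CV; rewrite th1; lra.
  have pickz k : exists z, pinned K (q k).1 th z.
    have [Ck _] := Hq k; have [z Hz] := CZ _ th Ck; exists z => y.
    have := CP _ (Hz 1 ltac:(lra)) (vsub y th); rewrite /zoom ray_sub.
    by rewrite !Rmult_1_l Rdiv_1_r.
  pose z k := epsilon (inhabits th) (fun z => pinned K (q k).1 th z).
  have Hz k : pinned K (q k).1 th (z k) := epsilon_spec _ _ (pickz k).
  have Hc : ucv (fun k => (q k).1 (q k).2 - (q k).1 th) 0.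
    apply: (@pinned_cv _ (fun k => (q k).1) (fun _ => th) z _ th K (K * (3 * norm2 th + 3))) => //.
    - exact: om_all.
    - apply: om_all => k i; apply: pinned_slope_bound (Hz k) _ => y; apply: CP; by case: (Hq k).
    - exact: vcv_const.
  have := ucv_minus (ucv_const m) ucv_inv; rewrite Rminus_0_r => Hm.
  have := ucv_plus Hc (HV th); rewrite Rplus_0_l => Hv.
  by apply: ucv_le Hm Hv; apply: om_all => k; have [_ [_ ?]] := Hq k; lra.
(* The concave function [V - m |x|^2] is nonpositive and vanishes at both ends of the segment. *)
have segm t : 0 <= t <= 1 -> V (ray (vzero _) t th) = m * (t * t).
  move=> t01; apply: Rle_antisym.
    by have := leM _ (ray (vzero _) t th) CV; rewrite norm2_ray0 th1; lra.
  have [z [_ Ht]] := tangent _ (ray (vzero _) t th) CV.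
  have := Ht (vzero _); have := Ht th.
  have -> : vsub th (ray (vzero _) t th) = ray (vzero _) (1 - t) th.
    by apply: functional_extensionality => i; rewrite /vsub /ray /vzero; ring.
  have -> : vsub (vzero _) (ray (vzero _) t th) = ray (vzero _) (- t) th.
    by apply: functional_extensionality => i; rewrite /vsub /ray /vzero; ring.
  rewrite !dot_ray0 !norm2_ray0 norm2_0 th1 Vth (C0 _ CV).
  move: (dot _ th) => c; move: (V _) => v; nra.
have [W [CW Wline]] : exists W, C W /\ forall t, W (ray (vzero _) t th) = m * (t * t).
  have [z [Hz _]] := tangent _ (ray (vzero _) (/2) th) CV.
  have line r t : 0 < r -> 0 <= /2 + t * r <= 1 ->
      zoom V (ray (vzero _) (/2) th) z r (ray (vzero _) t th) = m * (t * t) + t * (m - dot z th) / r.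
    move=> r0 tr; rewrite /zoom dot_ray0.
    have -> : ray (ray (vzero _) (/ 2) th) r (ray (vzero _) t th) = ray (vzero _) (/2 + t * r) th.
      by apply: functional_extensionality => i; rewrite /ray /vzero; ring.
    rewrite !segm; [field; lra|lra|lra].
  (* Otherwise the zoom would exceed [m |x|^2] on one side of the origin along [th]. *)
  have cz : m - dot z th = 0.
    have L t : Rabs t <= /2 -> t * (m - dot z th) <= 0.
      move=> tb; have := leM _ (ray (vzero _) t th) (Hz 1 ltac:(lra)).
      by rewrite line ?norm2_ray0 ?th1; [lra|lra|move: tb; split_Rabs; lra].
    have := L (/2); have := L (-/2); split_Rabs; lra.
  have r0 k : 0 < / (INR k + 1) by apply: Rinv_0_lt_compat; have := pos_INR k; lra.
  have [W HW] : exists W, forall y, ucv (fun k => zoom V (ray (vzero _) (/2) th) z (/ (INR k + 1)) y) (W y).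
    apply: (@pointwise_limit _ _ (fun y => K * norm2 y)) => y; apply: om_all => k.
    exact/CP/Hz.
  exists W; split; first by apply: CL HW => k; apply: Hz.
  move=> t; apply: (ucv_unique (HW _)); apply: ucv_eq (ucv_const _).
  have H := ucv_scal t ucv_inv; rewrite Rmult_0_r in H.
  apply: om_mono (H (/2) _) _; first lra.
  by move=> k; rewrite Rminus_0_r => Hk; rewrite line // ?cz; [field; have := pos_INR k; lra|move: Hk; split_Rabs; lra].
(* The plane above [W - m |x|^2] touching at [a] stays nonnegative along the line, so its slope
   along [th] is zero. Hence no translation along [th] increases the function, and neither does the
   reverse one. *)
have Ginv x t : W (ray x t th) - m * norm2 (ray x t th) = W x - m * norm2 x.
  have le1 a y : (exists t, y = ray a t th) -> W y - m * norm2 y <= W a - m * norm2 a.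
    move=> [s ->]; have [z [_ Ht]] := tangent _ a CW.
    have eta0 : dot (ray z (- 2 * m) a) th = 0.
      have L s' : 0 <= W a - m * norm2 a - dot (ray z (- 2 * m) a) a + s' * dot (ray z (- 2 * m) a) th.
        have := Ht (ray (vzero _) s' th); rewrite dot_sub dot_ray0 norm2_ray0 th1 Wline; lra.
      set c := dot _ th in L *; set b := W a - m * norm2 a - _ in L.
      apply: NNPP => c0; have := L (- (b + 1) / c); have -> : - (b + 1) / c * c = - (b + 1) by field.
      lra.
    by have := Ht (ray a s th); rewrite vsub_ray dot_ray0 eta0; lra.
  apply: Rle_antisym; apply: le1; first by exists t.
  by exists (- t); apply: functional_extensionality => i; rewrite /ray; ring.
(* [proj] is the projection along [th] onto the hyperplane where coordinate [i0] vanishes, with that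
   coordinate dropped; [emb] is its section. *)
have [i0 thi] : exists i0, th i0 <> 0.
  apply: NNPP => nth0; have := th1; have -> : th = vzero _.
    by apply: functional_extensionality => i; apply: NNPP => Hi; apply: nth0; exists i.
  by rewrite norm2_0; lra.
pose emb (y : vec n) : vec n.+1 := fun i => if unlift i0 i is Some l then y l else 0.
pose proj (x : vec n.+1) : vec n := fun l => x (lift i0 l) - x i0 / th i0 * th (lift i0 l).
have emb_l y l : emb y (lift i0 l) = y l by rewrite /emb liftK.
have emb_0 y : emb y i0 = 0 by rewrite /emb unlift_none.
have projK x : x = ray (emb (proj x)) (x i0 / th i0) th.
  apply: functional_extensionality => i; rewrite /ray; case: (unliftP i0 i) => [l|] ->.
    by rewrite emb_l /proj; ring.
  by rewrite emb_0; field.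
have embK y : proj (emb y) = y.
  by apply: functional_extensionality => l; rewrite /proj emb_l emb_0; field.
have proj_ray x t y : proj (ray x t y) = ray (proj x) t (proj y).
  by apply: functional_extensionality => l; rewrite /proj /ray; field.
have proj_th : proj th = vzero n.
  by apply: functional_extensionality => l; rewrite /proj /vzero; field.
have dot_emb x y : dot x (emb y) = dot (fun l => x (lift i0 l)) y.
  rewrite /dot /sumR (bigD1_ord i0) //= emb_0 Rmult_0_r Monoid.mul1m.
  by apply: eq_bigr => l _; rewrite emb_l.
have norm2_emb y : norm2 (emb y) = norm2 y.
  rewrite -!dot_norm2 dot_emb; congr dot.
  by apply: functional_extensionality => l; rewrite emb_l.
pose lft (V' : vec n -> R) : vec n.+1 -> R := fun x => m * norm2 x + V' (proj x).
have [A' CA'] : exists A', C (lft (quad A')).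
  (* The induction runs on the transverse parts of members of [C]; subtracting [m |x|^2] costs the
     extra [Rabs m]. *)
  apply: (IH (fun V' => C (lft V')) (K + Rabs m)).
  - move=> V' CV' y; have := CP _ CV' (emb y); rewrite /lft embK norm2_emb.
    by have := norm2_ge0 y; have := Rle_abs m; have := Rle_abs (- m); rewrite Rabs_Ropp; split_Rabs; nra.
  - move=> V' a CV'; have [z Hz] := CZ _ (emb a) CV'.
    exists (fun l => ray z (- 2 * m) (emb a) (lift i0 l)) => r r0.
    suff <- : zoom (lft V') (emb a) z r = lft (zoom V' a (fun l => ray z (- 2 * m) (emb a) (lift i0 l)) r) by apply: Hz.
    (* Along [th] the lift is exactly [m |x|^2], so a zoom of quadratic growth must use the
       derivative of that function. *)
    have zth : dot z th = 2 * m * dot (emb a) th.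
      have L s : s * (2 * m * dot (emb a) th - dot z th) <= (K - m) * (s * s).
        have := CP _ (Hz 1 ltac:(lra)) (ray (vzero _) s th).
        rewrite /zoom /lft (norm2_ray (emb a)) !dot_ray0 !norm2_ray0 th1 !proj_ray proj_th.
        have -> : ray (proj (emb a)) 1 (ray (proj (vzero n.+1)) s (vzero n)) = proj (emb a).
          by apply: functional_extensionality => l; rewrite /ray /vzero /proj; field.
        have -> : forall u, u / (1 * 1) = u by move=> u; field.
        by split_Rabs; lra.
      apply: Rle_antisym.
        suff : dot z th - 2 * m * dot (emb a) th <= 0 by lra.
        by apply: (@lin_small _ (K - m)) => t _; have := L (- t); lra.
      suff : 2 * m * dot (emb a) th - dot z th <= 0 by lra.
      by apply: (@lin_small _ (K - m)) => t _; have := L t; lra.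
    apply: functional_extensionality => x; rewrite /zoom /lft proj_ray embK norm2_ray.
    have -> : dot (fun l => ray z (- 2 * m) (emb a) (lift i0 l)) (proj x) = dot z x - 2 * m * dot (emb a) x.
      rewrite -dot_emb {2 3}(projK x) !dot_rayl !dot_ray zth; ring.
    field; lra.
  - move=> Vn V' Cn Hn; apply: CL Cn _ => x; apply: ucv_plus (Hn _); exact: ucv_const.
  - exists (fun y => W (emb y) - m * norm2 (emb y)).
    suff -> : lft (fun y => W (emb y) - m * norm2 (emb y)) = W by [].
    apply: functional_extensionality => x; rewrite /lft.
    by have := Ginv (emb (proj x)) (x i0 / th i0); rewrite -projK; lra.
pose P (l : 'I_n) (i : 'I_n.+1) := ebasis (lift i0 l) i - th (lift i0 l) / th i0 * ebasis i0 i.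
exists (madd (mscal m) (mcongr A' P)).
suff <- : lft (quad A') = quad (madd (mscal m) (mcongr A' P)) by [].
apply: functional_extensionality => x; rewrite quad_madd quad_mscal -quad_mcongr /lft; congr (_ + quad _ _).
apply: functional_extensionality => l; rewrite /proj /P -(dot_ebasis x) -(dot_ebasis x i0).
transitivity (dot (ray (ebasis (lift i0 l)) (- (th (lift i0 l) / th i0)) (ebasis i0)) x).
  by rewrite dot_rayl !(dotC x); field.
by apply: sumR_ext => i; rewrite /ray; ring.
Qed.

(** * Degenerate elliptic operators and quadratic test functions *)

Section Jets.
Variable N : nat.
Implicit Types (F : mat N -> R) (f u U V : vec N -> R) (a p x y z : vec N) (A : mat N).

(** With [c = 0] this is monotonicity, and [F] sees only the quadratic form, hence only the
    symmetric part of a matrix. A negative [c] is what creates strict inequalities. *)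
Definition elliptic F : Prop := forall A B c,
  (forall v, quad A v <= quad B v + c * norm2 v) -> F A <= F B + c.

Definition dualF F : mat N -> R := fun A => - F (mopp A).

Lemma elliptic_dual F : elliptic F -> elliptic (dualF F).
Proof.
move=> HF A B c H; rewrite /dualF; suff : F (mopp B) <= F (mopp A) + c by lra.
by apply: HF => v; rewrite !quad_mopp; have := H v; lra.
Qed.

(* Viscosity subsolution inequality [F (D^2 phi) >= s] at [x], for quadratic
   polynomials [phi] touching [f] from above on [S].  Supersolutions of [F] are
   subsolutions of [dualF F] after a change of sign. *)
Definition subj F (s : R) (S : vec N -> Prop) f x : Prop := forall p A r, 0 < r ->
  (forall y, S y -> near x r y -> f y <= f x + dot p (vsub y x) + quad A (vsub y x) / 2) ->
  s <= F A.

Definition everywhere : vec N -> Prop := fun _ => True.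

Definition usc f : Prop := forall x, usc_on everywhere f x.

Lemma quad_0 A : quad A (vzero N) = 0.
Proof.
rewrite /quad /vzero (sumR_ext (g := fun _ => 0)) ?sumR_const => [|i]; first by ring.
by rewrite (sumR_ext (g := fun _ => 0)) ?sumR_const => [|k]; ring.
Qed.

Lemma quad_scal A t y : quad A (ray (vzero N) t y) = t * t * quad A y.
Proof.
rewrite quad_ray quad_0; have -> : quadgrad A (vzero N) = vzero N.
  apply: functional_extensionality => k; rewrite /quadgrad /vzero.
  by rewrite (sumR_ext (g := fun _ => 0)) ?sumR_const => [|i]; ring.
by rewrite dot_0l; ring.
Qed.

Lemma subj_zoom F s f a z r x : 0 < r ->
  subj F s everywhere f (ray a r x) -> subj F s everywhere (zoom f a z r) x.
Proof.
move=> r0 H p A e e0 Ht; apply: (H (ray z r p) A (r * e)); first nra.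
move=> y _ yn; pose w := ray (vzero N) (/ r) (vsub y a).
have Ey : y = ray a r w by apply: functional_extensionality => i; rewrite /w /ray /vsub /vzero; field; lra.
have nw : near x e w.
  move=> i; have := yn i; rewrite Ey /ray.
  have -> : a i + r * w i - (a i + r * x i) = r * (w i - x i) by ring.
  rewrite Rabs_mult (Rabs_pos_eq r); last lra.
  by move=> Hr; apply: (Rmult_lt_reg_l r).
have := Ht w I nw; rewrite Ey /zoom.
have -> : vsub (ray a r w) (ray a r x) = ray (vzero N) r (vsub w x).
  by apply: functional_extensionality => i; rewrite /ray /vsub /vzero; ring.
rewrite quad_scal dot_ray0 dot_rayl (dot_sub z).
move: (quad _ _) (dot p _) => q d.
move=> Hq; have : (f (ray a r w) - f a - r * dot z w) / (r * r) * (r * r) <=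
   ((f (ray a r x) - f a - r * dot z x) / (r * r) + d + q / 2) * (r * r).
  by apply: Rmult_le_compat_r => //; nra.
have E (c : R) : c / (r * r) * (r * r) = c by field; lra.
by rewrite !Rmult_plus_distr_r !E; lra.
Qed.

Lemma zoom_opp f a z r : (fun y => - zoom f a z r y) =
  zoom (fun y => - f y) a (ray (vzero N) (-1) z) r.
Proof.
by apply: functional_extensionality => y; rewrite /zoom (dotC (ray _ _ _)) dot_ray0 (dotC y) /Rdiv; ring.
Qed.

(** Adding [2e] times the identity to [A] makes the contact at [a] strict. Maximisers of [Un n]
    minus the test polynomial on a small ball then tend to [a], and the polynomial recentred there
    tests [Un n]. Ellipticity returns [e] to zero. The inequality for [Un] is needed only along
    sequences tending to [a]. *)
Lemma subj_stable F s (Un : nat -> vec N -> R) U a : elliptic F ->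
  (forall Y y, vcv Y y -> ucv (fun n => Un n (Y n)) (U y)) ->
  (forall n, usc (Un n)) ->
  (forall Y, vcv Y a -> om (fun n => subj F s everywhere (Un n) (Y n))) ->
  subj F s everywhere U a.
Proof.
move=> HF cc us sub p A r r0 Ht.
suff K e : 0 < e -> s <= F A + 2 * e.
  by apply: Rnot_lt_le => Hlt; have := K ((s - F A) / 4) ltac:(lra); lra.
move=> e0.
pose S y := norm2 (vsub y a) <= r * r / 4.
pose A' := madd A (mscal (2 * e)).
have qA' x : quad A' x = quad A x + 2 * e * norm2 x by rewrite quad_madd quad_mscal.
pose f n y := Un n y - (dot p (vsub y a) + quad A' (vsub y a) / 2).
have Sa : S a by rewrite /S vsub_self norm2_0; nra.
have Pcv Y y : vcv Y y -> ucv (fun n => dot p (vsub (Y n) a) + quad A' (vsub (Y n) a) / 2)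
    (dot p (vsub y a) + quad A' (vsub y a) / 2).
  move=> HY; have HYa : vcv (fun n => vsub (Y n) a) (vsub y a) by apply: vcv_sub => //; apply: vcv_const.
  apply: ucv_plus; first by apply: ucv_dot => //; apply: vcv_const.
  have := ucv_scal (/2) (ucv_quad A' HYa); rewrite (Rmult_comm (/2) (quad A' (vsub y a))).
  by apply: ucv_eq; apply: om_all => n; rewrite Rmult_comm.
have Scl Y y : om (fun n => S (Y n)) -> vcv Y y -> S y.
  move=> SY HY; apply: ucv_le SY _ (ucv_const _); apply: ucv_norm2.
  by apply: vcv_sub => //; apply: vcv_const.
have Sbd y : S y -> norm2 y <= r * r / 2 + 2 * norm2 a.
  move=> Sy; have := norm2_ray_le a 1 (vsub y a); rewrite ray_sub; move: Sy; rewrite /S; lra.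
have amax n : exists y, S y /\ forall x, S x -> f n x <= f n y.
  apply: (argmax (x0 := a) (K := r * r / 2 + 2 * norm2 a)) => //.
  - by move=> x Sx _; apply: Sbd.
  - by move=> X x SX _; apply: Scl; apply: om_all.
  - move=> x _ X SX HX d d0.
    have H1 := us n x X (fun=> I) HX (d/2) ltac:(lra).
    have H2 := ucv_gt (Pcv X x HX) (c := dot p (vsub x a) + quad A' (vsub x a) / 2 - d/2) ltac:(lra).
    by apply: om_mono2 H1 H2 _ => k; rewrite /f; lra.
pose Y n := epsilon (inhabits a) (fun y => S y /\ forall x, S x -> f n x <= f n y).
have HY n : S (Y n) /\ forall x, S x -> f n x <= f n (Y n) := epsilon_spec _ _ (amax n).
have [y Hy] : exists y, vcv Y y.
  by apply: (@vcv_bounded _ _ (r * r / 2 + 2 * norm2 a)); apply: om_all => n; apply: Sbd; case: (HY n).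
have Sy : S y by apply: Scl Hy; apply: om_all => n; case: (HY n).
have Eya : norm2 (vsub y a) = 0.
  have Hle : U a <= U y - (dot p (vsub y a) + quad A' (vsub y a) / 2).
    apply: (ucv_le _ (cc _ _ (vcv_const a)) (ucv_minus (cc _ _ Hy) (Pcv _ _ Hy))).
    apply: om_all => n; have [_ H] := HY n; have := H a Sa; rewrite /f vsub_self dot_0r quad_0; lra.
  have := Ht y I (near_norm2 r0 _); rewrite qA' in Hle.
  have := norm2_ge0 (vsub y a); move: Sy; rewrite /S => ? ?; nra.
have Hya : vcv Y a.
  apply: vcv_dist; have := ucv_norm2 (vcv_sub Hy (vcv_const y)); rewrite vsub_self norm2_0.
  apply: ucv_eq; apply: om_all => n; congr norm2.
  apply: functional_extensionality => i; have := f_equal (fun g => g i) (norm2_eq0 Eya).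
  by rewrite /vsub /vzero; lra.
have Hs := ucv_lt (ucv_dist Hya) (c := r * r / 16) ltac:(nra).
have [n [subn closen]] := om_ex (om_and (sub Y Hya) Hs).
suff : s <= F A'.
  by move=> sA; apply: Rle_trans sA _; apply: HF => v; rewrite qA'; lra.
have [SYn mx] := HY n.
have N0 := pos_INR N.
(* The gradient is that of the polynomial at [Y n]. The factor [INR N + 1] fits a sup-norm box into
   a Euclidean ball, so that with [Y n] within [r/4] of [a] the box stays in [S]. *)
apply: (subn (ray p (/2) (quadgrad A' (vsub (Y n) a))) A' (r / (4 * (INR N + 1)))).
  by apply: Rdiv_lt_0_compat; lra.
move=> x _ nx.
have Sx : S x.
  have : norm2 (vsub x (Y n)) <= INR N * (r / (4 * (INR N + 1)) * (r / (4 * (INR N + 1)))).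
    by apply: norm2_box => i; have := nx i; rewrite /vsub; lra.
  have -> : INR N * (r / (4 * (INR N + 1)) * (r / (4 * (INR N + 1)))) =
    r * r / 16 * (INR N / (INR N + 1) * / (INR N + 1)) by field; lra.
  have d1 : INR N / (INR N + 1) <= 1.
    by apply: (Rmult_le_reg_r (INR N + 1)); [lra|rewrite /Rdiv Rmult_assoc Rinv_l; lra].
  have d2 : / (INR N + 1) <= 1 by rewrite -Rinv_1; apply: Rinv_le_contravar; lra.
  have d3 : 0 < / (INR N + 1) by apply: Rinv_0_lt_compat; lra.
  have d4 : INR N / (INR N + 1) * / (INR N + 1) <= 1 by nra.
  have := norm2_ray_le (vsub (Y n) a) 1 (vsub x (Y n)).
  have -> : ray (vsub (Y n) a) 1 (vsub x (Y n)) = vsub x a.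
    by apply: functional_extensionality => i; rewrite /ray /vsub; ring.
  rewrite /S; nra.
have := mx x Sx; rewrite /f.
have Exa : vsub x a = ray (vsub (Y n) a) 1 (vsub x (Y n)).
  by apply: functional_extensionality => i; rewrite /ray /vsub; ring.
rewrite Exa quad_ray dot_ray dot_rayl; lra.
Qed.

(** Contact points become dense only in the limit, so the expansion at [a] is asked at anchors [an]
    tending to [a]. *)
Definition asymptotically_pinned (K : R) (Vn : nat -> vec N -> R) : Prop :=
  (forall n y, Rabs (Vn n y) <= K * norm2 y) /\
  forall a, exists an zn, vcv an a /\ om (fun n => pinned K (Vn n) (an n) (zn n)).

(** Quadratic growth bounds the slopes at the anchors, so they converge and the expansion passes to
    the limit. Comparing values through an anchor upgrades pointwise to continuous convergence, as
    [subj_stable] requires. *)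
Lemma asymptotically_pinned_limit K Vn V : asymptotically_pinned K Vn ->
  (forall y, ucv (fun n => Vn n y) (V y)) ->
  (forall a, exists z, pinned K V a z) /\
  (forall Y y, vcv Y y -> ucv (fun n => Vn n (Y n)) (V y)).
Proof.
move=> [bd ap] HV.
have slopes a : exists an zn D, [/\ vcv an a, om (fun n => pinned K (Vn n) (an n) (zn n))
    & om (fun n => forall i, Rabs (zn n i) <= D)].
  have [an [zn [Ha Hp]]] := ap a; exists an, zn, (Rabs K * (3 * norm2 a + 6)); split=> //.
  apply: om_mono2 Hp (vcv_norm2_bounded Ha) _ => n Hp Hn i.
  apply: Rle_trans (pinned_slope_bound i Hp (bd n)) _.
  apply: Rle_trans (Rmult_le_compat_r _ _ _ _ (Rle_abs K)) _; first by have := norm2_ge0 (an n); lra.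
  by apply: Rmult_le_compat_l; [exact: Rabs_pos|lra].
have cc Y y : vcv Y y -> ucv (fun n => Vn n (Y n)) (V y).
  move=> HY; have [an [zn [D [Ha Hp Hz]]]] := slopes y.
  have H := ucv_plus (HV y) (ucv_minus (pinned_cv Hp Hz Ha HY) (pinned_cv Hp Hz Ha (vcv_const y))).
  rewrite Rminus_0_r Rplus_0_r in H.
  by apply: ucv_eq H; apply: om_all => n; ring.
split=> // a; have [an [zn [D [Ha Hp Hz]]]] := slopes a.
have [z Hzz] := vcv_box Hz.
exists z => y.
have Hs : vcv (fun n => vsub y (an n)) (vsub y a) by apply: vcv_sub => //; apply: vcv_const.
have H1 := ucv_minus (ucv_minus (HV y) (cc _ _ Ha)) (ucv_dot Hzz Hs).
have H2 := ucv_scal K (ucv_norm2 Hs).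
apply: Rabs_le; split.
  by apply: ucv_le _ (ucv_opp H2) H1; apply: om_mono Hp _ => n /(_ y); split_Rabs; lra.
by apply: ucv_le _ H1 H2; apply: om_mono Hp _ => n /(_ y); split_Rabs; lra.
Qed.

Lemma pinned_usc K V : (forall a, exists z, pinned K V a z) -> usc V.
Proof.
move=> H x X _ HX e e0; have [z Hz] := H x.
have Hd : vcv (fun n => vsub (X n) x) (vsub x x) by apply: vcv_sub => //; apply: vcv_const.
rewrite vsub_self in Hd.
have := ucv_plus (ucv_dot (vcv_const z) Hd) (ucv_scal K (ucv_norm2 Hd)).
rewrite dot_0r norm2_0 Rmult_0_r Rplus_0_r => /ucv_lt /(_ e0) H1.
by apply: om_mono H1 _ => n; have := Hz (X n); split_Rabs; lra.
Qed.

Lemma pinned_opp K V a z : pinned K V a z -> pinned K (fun y => - V y) a (ray (vzero N) (-1) z).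
Proof.
move=> H y; have := H y; rewrite (dotC (ray _ _ _)) dot_ray0 (dotC (vsub y a)).
by move: (dot _ _) => d; split_Rabs; lra.
Qed.

Lemma pinned_zoom K V a z r b zb : 0 < r -> pinned K V (ray a r b) zb ->
  pinned K (zoom V a z r) b (ray (ray (vzero N) (/ r) zb) (- / r) z).
Proof.
move=> r0 H y; have := H (ray a r y); rewrite /zoom.
have -> : vsub (ray a r y) (ray a r b) = ray (vzero N) r (vsub y b).
  by apply: functional_extensionality => i; rewrite /ray /vsub /vzero; ring.
rewrite norm2_ray0 dot_ray0 !dot_rayl dot_0l !dot_sub.
move=> Hr; have rr : 0 < r * r by nra.
apply: (Rmult_le_reg_l (r * r)) => //.
have -> c : r * r * (K * c) = K * (r * r * c) by ring.
apply: Rle_trans _ Hr; right.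
rewrite -[X in X * _](Rabs_pos_eq (r * r)); last lra.
by rewrite -Rabs_mult; congr Rabs; field; lra.
Qed.

Lemma pinned_zoom_bound K V a z r y : 0 < r -> pinned K V a z ->
  Rabs (zoom V a z r y) <= K * norm2 y.
Proof.
move=> r0 Hz; have := Hz (ray a r y); rewrite /zoom vsub_ray dot_ray0 norm2_ray0 => H.
have rr : 0 < r * r by nra.
rewrite /Rdiv Rabs_mult (Rabs_pos_eq (/ _)); last by left; apply: Rinv_0_lt_compat.
apply: (Rmult_le_reg_r (r * r)) => //; rewrite Rmult_assoc Rinv_l; lra.
Qed.

(** The hypotheses are stable under zooms and pointwise limits, so some quadratic form satisfies
    them. It is its own test function from both sides, whence [s <= F (2A) <= 0]. *)
Lemma smooth_solution_absurd F (s K : R) V : elliptic F -> 0 < s ->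
  (forall y, Rabs (V y) <= K * norm2 y) ->
  (forall a, exists z, pinned K V a z) ->
  (forall a, subj F s everywhere V a) ->
  (forall a, subj (dualF F) 0 everywhere (fun y => - V y) a) -> False.
Proof.
move=> HF s0 bd pin sub sup.
pose C (W : vec N -> R) := [/\ forall y, Rabs (W y) <= K * norm2 y,
  forall a, exists z, pinned K W a z, forall a, subj F s everywhere W a
  & forall a, subj (dualF F) 0 everywhere (fun y => - W y) a].
have [||||A [_ _ subA supA]] := @quadratic_in_class N C K.
- by move=> W [].
- move=> W a [Wb Wp Ws Wt]; have [z Hz] := Wp a; exists z => r r0; split.
  + by move=> y; apply: pinned_zoom_bound.
  + by move=> b; have [zb Hb] := Wp (ray a r b); eexists; apply: pinned_zoom Hb.
  + by move=> b; apply: subj_zoom.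
  + by move=> b; rewrite zoom_opp; apply: subj_zoom.
- move=> Vn W CVn HW.
  have ap : asymptotically_pinned K Vn.
    split; first by move=> n; case: (CVn n).
    move=> a; have pk n : exists z, pinned K (Vn n) a z by case: (CVn n).
    exists (fun _ => a), (fun n => epsilon (inhabits a) (fun z => pinned K (Vn n) a z)).
    by split; [exact: vcv_const|apply: om_all => n; apply: epsilon_spec (pk n)].
  have [Wp cc] := asymptotically_pinned_limit ap HW.
  split=> //.
  + move=> y; have H := HW y; apply: Rabs_le.
    split; [apply: ucv_le _ (ucv_const _) H | apply: ucv_le _ H (ucv_const _)];
    apply: om_all => n; case: (CVn n) => /(_ y) Hb _ _ _; move: Hb; split_Rabs; lra.
  + move=> a; apply: (subj_stable HF cc) => [n|Y HY]; last by apply: om_all => n; case: (CVn n).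
    by case: (CVn n) => _ Hp _ _; apply: pinned_usc Hp.
  + move=> a; apply: (subj_stable (elliptic_dual HF) (Un := fun n y => - Vn n y)).
    * by move=> Y y HY; apply/ucv_opp/cc.
    * move=> n; case: (CVn n) => _ Hp _ _; apply: (@pinned_usc K) => b.
      by have [z Hz] := Hp b; eexists; apply: pinned_opp Hz.
    * by move=> Y HY; apply: om_all => n; case: (CVn n).
- by exists V.
have q0 := quad_0 A.
have v0 y : vsub y (vzero N) = y by apply: functional_extensionality => i; rewrite /vsub /vzero; ring.
(* The matrix is doubled because [subj] tests with half a quadratic form. *)
have H1 : s <= F (madd A A).
  apply: (subA (vzero N) (vzero N) _ 1) => [|y _ _]; first lra.
  rewrite v0 quad_madd dot_0l; lra.
have H2 : 0 <= dualF F (mopp (madd A A)).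
  apply: (supA (vzero N) (vzero N) _ 1) => [|y _ _]; first lra.
  rewrite v0 quad_mopp quad_madd dot_0l; lra.
have : F (madd A A) <= F (mopp (mopp (madd A A))) + 0.
  by apply: HF => v; rewrite !quad_mopp; lra.
move: H2; rewrite /dualF; lra.
Qed.

End Jets.

Arguments everywhere {N}.

(** * Images of expansive maps are dense in some cube *)

Section DenseCube.
Variable N : nat.
Implicit Types (A : vec N -> Prop) (c x y p q : vec N).

(** Half-open, so that a cube is partitioned by its subcubes. *)
Definition incube c (s : R) x : Prop := forall i, c i <= x i < c i + s.

Definition dense_in A c (s r : R) : Prop :=
  forall y, incube c s y -> exists x, A x /\ forall i, Rabs (x i - y i) <= r.

Lemma subinterval (b : nat) (t d : R) : 0 < d -> 0 <= t < INR b * d ->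
  exists k : 'I_b, INR k * d <= t < INR k * d + d.
Proof.
move=> d0; elim: b => [|b IH]; first by rewrite /= ; lra.
rewrite S_INR => Ht; case: (Rlt_le_dec t (INR b * d)) => Hb.
  have [k Hk] := IH (conj (proj1 Ht) Hb); exists (widen_ord (leqnSn b) k) => //.
by exists ord_max => /=; lra.
Qed.

Lemma INR_expn (a k : nat) : INR (expn a k) = INR a ^ k.
Proof. by elim: k => [|k IH] //; rewrite expnS mult_INR IH. Qed.

Lemma subcube (b : nat) c s x : (0 < b)%N -> 0 < s -> incube c s x ->
  exists g : {ffun 'I_N -> 'I_b}, incube (fun i => c i + INR (g i) * (s / INR b)) (s / INR b) x.
Proof.
move=> b0 s0 xc; have bp : 0 < INR b by apply: lt_0_INR; apply/ltP.
have d0 : 0 < s / INR b by apply: Rdiv_lt_0_compat.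
have H i : exists k : 'I_b, INR k * (s / INR b) <= x i - c i < INR k * (s / INR b) + s / INR b.
  apply: subinterval => //; have := xc i.
  have -> : INR b * (s / INR b) = s by field; lra.
  lra.
exists [ffun i => epsilon (inhabits (Ordinal b0)) (fun k : 'I_b =>
   INR k * (s / INR b) <= x i - c i < INR k * (s / INR b) + s / INR b)] => i.
by rewrite ffunE; have := epsilon_spec (inhabits (Ordinal b0)) _ (H i); lra.
Qed.

Lemma sparse_subcubes A (b : nat) c s : (0 < b)%N -> 0 < s ->
  ~ dense_in A c s (s / INR b) ->
  exists h : 'I_(expn b N).-1 -> vec N, forall x, A x -> incube c s x ->
    exists j, incube (h j) (s / INR b) x.
Proof.
move=> b0 s0 nd; have [y Hy] := not_all_ex_not _ _ nd; have [yc nA] := imply_to_and _ _ Hy.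
have [gy Hgy] := subcube b0 s0 yc.
pose l := rem gy (enum {: {ffun 'I_N -> 'I_b}}).
have sl : size l = (expn b N).-1.
  by rewrite size_rem ?mem_enum // -cardE card_ffun !card_ord.
exists (fun j i => c i + INR ((nth gy l j : {ffun 'I_N -> 'I_b}) i) * (s / INR b)) => x Ax xc.
have [g Hg] := subcube b0 s0 xc.
have ng : g != gy.
  apply/eqP => E; apply: nA; exists x; split=> // i.
  by have := Hg i; have := Hgy i; rewrite E; split_Rabs; lra.
have gl : g \in l by rewrite mem_rem_uniq ?enum_uniq // inE ng mem_enum.
have il : (index g l < (expn b N).-1)%N by rewrite -sl index_mem.
by exists (Ordinal il); rewrite /= nth_index.
Qed.

Lemma sparse_cover A (b : nat) (s : R) (k : nat) c : (0 < b)%N -> 0 < s ->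
  (forall c' s', 0 < s' <= s -> ~ dense_in A c' s' (s' / INR b)) ->
  exists (T : finType) (h : T -> vec N), #|T| = expn (expn b N).-1 k /\
    forall x, A x -> incube c s x -> exists j, incube (h j) (s / INR b ^ k) x.
Proof.
move=> b0 s0 H; have b1 : 1 <= INR b by rewrite -INR_1; apply: le_INR; apply/leP.
elim: k => [|k [T [h [cT Hh]]]].
  exists unit, (fun _ => c); rewrite card_unit; split=> // x Ax xc; exists tt.
  by rewrite /= Rdiv_1_r.
have bk := pow_R1_Rle _ k b1.
have sk : 0 < s / INR b ^ k <= s.
  split; first by apply: Rdiv_lt_0_compat; lra.
  by apply: (Rmult_le_reg_r (INR b ^ k)); [lra|rewrite /Rdiv Rmult_assoc Rinv_l; nra].
have step t := sparse_subcubes b0 (proj1 sk) (H (h t) _ sk).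
pose h' t := epsilon (inhabits (fun _ => c)) (fun f : 'I_(expn b N).-1 -> vec N =>
  forall x, A x -> incube (h t) (s / INR b ^ k) x -> exists j, incube (f j) (s / INR b ^ k / INR b) x).
have Hh' t : forall x, A x -> incube (h t) (s / INR b ^ k) x ->
  exists j, incube (h' t j) (s / INR b ^ k / INR b) x := epsilon_spec _ _ (step t).
exists (prod T 'I_(expn b N).-1), (fun tj : T * _ => h' tj.1 tj.2); split.
  by rewrite card_prod cT card_ord expnSr.
move=> x Ax xc; have [t Ht] := Hh x Ax xc; have [j Hj] := Hh' t x Ax Ht.
exists (t, j); have -> : s / INR b ^ k.+1 = s / INR b ^ k / INR b; last exact: Hj.
by rewrite /=; field; lra.
Qed.

(** By Bernoulli's inequality the saving of one subcube per generation outweighs any fixed number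
    [K] of further generations. *)
Lemma power_gap (B : nat) (K : nat) : (1 < B)%N ->
  exists k, (expn B.-1 (k + K) < expn B k)%N.
Proof.
move=> B1; set a := INR B.-1.
have a1 : 1 <= a by rewrite /a -INR_1; apply: le_INR; apply/leP; rewrite -ltnS prednK // ltnW.
have EB : INR B = a + 1 by rewrite /a -S_INR prednK // ltnW.
have [k Hk] := INR_unbounded (a * a ^ K).
exists k; apply/ltP/INR_lt; rewrite !INR_expn EB -/a pow_add.
have -> : a + 1 = a * (1 + / a) by field; lra.
rewrite Rpow_mult_distr; apply: Rmult_lt_compat_l; first by apply: pow_lt; lra.
have ai : 0 < / a by apply: Rinv_0_lt_compat; lra.
have Hp := poly k (/ a) ai.
have : a * a ^ K * / a < INR k * / a.
  by apply: Rmult_lt_compat_r => //; apply: Rinv_0_lt_compat; lra.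
have -> : a * a ^ K * / a = a ^ K by field; lra.
lra.
Qed.

(** Pigeonhole in place of measure. Were no cube dense, [A] would be covered by [(b^N - 1)^(k+K)]
    cubes of side [S / b^(k+K)]. Expansiveness puts the images of the [b^(kN)] points of a grid of
    mesh [b^(-k)] into distinct ones, too many for large [k]. *)
Lemma dense_cube A c (S D : R) (X : vec N -> vec N) (b : nat) :
  (0 < N)%N -> (1 < b)%N -> 0 < S -> 0 < D ->
  (forall p, (forall i, 0 <= p i <= 1) -> A (X p) /\ incube c S (X p)) ->
  (forall p q r, (forall i, 0 <= p i <= 1) -> (forall i, 0 <= q i <= 1) -> 0 < r ->
     (forall i, Rabs (X p i - X q i) < r) -> forall i, Rabs (p i - q i) <= D * r) ->
  exists c' s, 0 < s <= S /\ dense_in A c' s (s / INR b).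
Proof.
move=> N0 b1 S0 D0 XA Xexp; apply: NNPP => nd.
have b0 : (0 < b)%N by apply: ltnW.
have bR : 2 <= INR b by rewrite -(INR_IZR_INZ 2); apply: le_INR; apply/leP.
(* These [K] extra generations absorb the constant: parameters whose images share a small cube are
   closer than the grid mesh. *)
have [K HK] := Pow_x_infinity (INR b) ltac:(rewrite Rabs_pos_eq; lra) (D * S + 1).
have {}HK : D * S < INR b ^ K.
  by have := HK K (le_n _); rewrite Rabs_pos_eq; [lra|apply: pow_le; lra].
have B1 : (1 < expn b N)%N by rewrite -{1}(expn0 b) ltn_exp2l.
have [k] := power_gap K B1; rewrite ltnNge => /negP; apply.
have [c' s' ss Hd|T [h [cT Hh]]] := @sparse_cover A b S (k + K) c b0 S0.
  by apply: nd; exists c', s'.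
have M0 : 0 < INR b ^ k by apply: pow_lt; lra.
pose p (g : {ffun 'I_N -> 'I_(expn b k)}) : vec N := fun i => INR (g i) / INR b ^ k.
have p01 g i : 0 <= p g i <= 1.
  have : (g i < expn b k)%N by []. move=> /ltP /lt_INR; rewrite INR_expn => gi.
  have g0 := pos_INR (g i); split; first by apply: Rmult_le_pos => //; left; apply: Rinv_0_lt_compat.
  by apply: (Rmult_le_reg_r (INR b ^ k)) => //; rewrite /p /Rdiv Rmult_assoc Rinv_l; lra.
have tex g : exists j, incube (h j) (S / INR b ^ (k + K)) (X (p g)).
  by have [? ?] := XA (p g) (p01 g); apply: Hh.
have t0 : T.
  have bk0 : (0 < expn b k)%N by rewrite expn_gt0 b0.
  by have [j _] := constructive_indefinite_description _ (tex [ffun=> Ordinal bk0]).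
pose t g := epsilon (inhabits t0) (fun j => incube (h j) (S / INR b ^ (k + K)) (X (p g))).
have Ht g : incube (h (t g)) (S / INR b ^ (k + K)) (X (p g)) := epsilon_spec _ _ (tex g).
have bkK : 0 < INR b ^ (k + K) by apply: pow_lt; lra.
have tinj : injective t.
  move=> g g' E; apply/ffunP => i; apply: NNPP => ng.
  have := Xexp (p g) (p g') (S / INR b ^ (k + K)) (p01 g) (p01 g') _ _ i.
  have -> : Rabs (p g i - p g' i) = Rabs (INR (g i) - INR (g' i)) / INR b ^ k.
    rewrite /p /Rdiv -Rmult_minus_distr_r Rabs_mult (Rabs_pos_eq (/ _)) //.
    by left; apply: Rinv_0_lt_compat.
  have g1 : 1 <= Rabs (INR (g i) - INR (g' i)).
    have : (g i < g' i)%N \/ (g' i < g i)%N.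
      by apply/orP; rewrite -neq_ltn; apply/eqP => /val_inj.
    by case=> /ltP; rewrite -Nat.le_succ_l => /le_INR; rewrite S_INR; split_Rabs; lra.
  have -> : D * (S / INR b ^ (k + K)) = (D * S / INR b ^ K) / INR b ^ k.
    by rewrite pow_add; field; split; apply: Rgt_not_eq => //; apply: pow_lt; lra.
  move=> H; have : Rabs (INR (g i) - INR (g' i)) / INR b ^ k <= D * S / INR b ^ K / INR b ^ k.
    apply: H; first by apply: Rdiv_lt_0_compat.
    by move=> l; have := Ht g l; have := Ht g' l; rewrite E; split_Rabs; lra.
  move=> /(Rmult_le_compat_r (INR b ^ k) _ _ (Rlt_le _ _ M0)).
  have E2 (u : R) : u / INR b ^ k * INR b ^ k = u by field; lra.
  rewrite !E2; suff : D * S / INR b ^ K < 1 by lra.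
  apply: (Rmult_lt_reg_r (INR b ^ K)); first by apply: pow_lt; lra.
  by rewrite /Rdiv Rmult_assoc Rinv_l ?Rmult_1_r ?Rmult_1_l //; apply: Rgt_not_eq; apply: pow_lt; lra.
have := leq_card t tinj; rewrite cT card_ffun !card_ord -!expnM.
by rewrite (mulnC k).
Qed.

End DenseCube.

(** * Comparison of a semiconvex subsolution with a semiconcave supersolution *)

Section SemiconvexComparison.
Variable N : nat.
Implicit Types (f u v w V : vec N -> R) (a p q x y z : vec N).

Definition semiconvex (C : R) f : Prop :=
  forall x, exists z, forall y, f x + dot z (vsub y x) - C * norm2 (vsub y x) <= f y.

Definition contact f p x : Prop := forall y, f y <= f x + dot p (vsub y x).

Lemma usc_zoom f a z r : 0 < r -> usc f -> usc (zoom f a z r).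
Proof.
move=> r0 uf x X _ HX e e0; have rr : 0 < r * r by nra.
have H1 := uf (ray a r x) (fun n => ray a r (X n)) (fun=> I) (vcv_ray r (vcv_const a) HX) (e * (r * r) / 2) ltac:(nra).
have H2 := ucv_scal r (ucv_dot (vcv_const z) HX).
have H3 := ucv_gt H2 (c := r * dot z x - e * (r * r) / 2) ltac:(nra).
apply: om_mono2 H1 H3 _ => n h1 h3; rewrite /zoom.
apply: (Rmult_lt_reg_r (r * r)) => //.
have E (c : R) : c / (r * r) * (r * r) = c by field; lra.
by rewrite Rmult_plus_distr_r !E; lra.
Qed.

Lemma zero_functional z (D : R) : (forall y, dot z y <= D * norm2 y) -> forall y, dot z y = 0.
Proof.
move=> H; suff K y : dot z y <= 0.
  by move=> y; apply: Rle_antisym (K y) _; have := K (ray (vzero N) (-1) y); rewrite dot_ray0; lra.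
apply: (@lin_small _ (D * norm2 y)) => t _.
by have := H (ray (vzero N) t y); rewrite dot_ray0 norm2_ray0; lra.
Qed.

(** The paraboloids below [u] and [- v] add up to one below [u - v], which is itself below the plane
    of slope [p]; so their slopes add up to [p]. *)
Lemma contact_slopes C u v p x : semiconvex C u -> semiconvex C (fun y => - v y) ->
  contact (fun y => u y - v y) p x ->
  exists z1 z2, [/\ forall y, u x + dot z1 (vsub y x) - C * norm2 (vsub y x) <= u y,
    forall y, - v x + dot z2 (vsub y x) - C * norm2 (vsub y x) <= - v y
  & forall y, dot z1 y + dot z2 y = dot p y].
Proof.
move=> Hu Hv Hc; have [z1 H1] := Hu x; have [z2 H2] := Hv x.
exists z1, z2; split=> // y.
suff : dot (vsub (ray z1 1 z2) p) y = 0 by rewrite dot_subl dot_rayl; lra.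
apply: (@zero_functional _ (2 * C)) => {}y.
have := H1 (ray x 1 y); have := H2 (ray x 1 y); have := Hc (ray x 1 y).
by rewrite !vsub_ray !dot_ray0 norm2_ray0 dot_subl dot_rayl; lra.
Qed.

(** At a contact point each function is held from one side by its own paraboloid and from the other
    by the plane and the paraboloid of the other function. *)
Lemma contact_pinned C u v p x : semiconvex C u -> semiconvex C (fun y => - v y) ->
  contact (fun y => u y - v y) p x ->
  exists z1 z2, pinned C u x z1 /\ pinned C v x z2.
Proof.
move=> Hu Hv Hc; have [z1 [z2 [H1 H2 H12]]] := contact_slopes Hu Hv Hc.
exists z1, (ray (vzero N) (-1) z2); split=> y; rewrite ?(dotC (ray _ _ _)) ?dot_ray0 ?(dotC _ z2);
  have := H12 (vsub y x); have := H1 y; have := H2 y; have := Hc y; split_Rabs; lra.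
Qed.

Lemma contact_lower C u v p x y : semiconvex C u -> semiconvex C (fun y => - v y) ->
  contact (fun y => u y - v y) p x ->
  u x - v x + dot p (vsub y x) - 2 * C * norm2 (vsub y x) <= u y - v y.
Proof.
move=> Hu Hv Hc; have [z1 [z2 [H1 H2 H12]]] := contact_slopes Hu Hv Hc.
have := H12 (vsub y x); have := H1 y; have := H2 y; lra.
Qed.

Lemma contact_expansive C u v p q x x' : 0 < C ->
  semiconvex C u -> semiconvex C (fun y => - v y) ->
  contact (fun y => u y - v y) p x -> contact (fun y => u y - v y) q x' ->
  norm2 (vsub p q) <= 16 * (C * C) * norm2 (vsub x x').
Proof.
move=> C0 Hu Hv Hp Hq; set e := vsub p q.
(* The step [t = 1/(4C)] maximises [t |e|^2 - 2 C t^2 |e|^2]. *)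
pose y := ray x (/ (4 * C)) e.
have := contact_lower x Hu Hv Hq; have := contact_lower y Hu Hv Hp; have := Hq y.
rewrite /y vsub_ray dot_ray0 norm2_ray0.
have -> : dot q (vsub (ray x (/ (4 * C)) e) x') = dot q (vsub x x') + / (4 * C) * dot q e.
  by rewrite (dot_sub _ (ray _ _ _)) (dot_sub _ x) dot_ray; ring.
move=> H1 H2 H3.
have Ee : dot p e - dot q e = norm2 e by rewrite -dot_subl.
have : / (4 * C) * norm2 e <= 2 * C * norm2 (vsub x x') + 2 * C * (/ (4 * C) * / (4 * C) * norm2 e).
  by rewrite -{1}Ee; lra.
have -> : 2 * C * (/ (4 * C) * / (4 * C) * norm2 e) = / (8 * C) * norm2 e by field; lra.
have -> : / (4 * C) = 2 * / (8 * C) by field; lra.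
move=> H4; have H5 : / (8 * C) * norm2 e <= 2 * C * norm2 (vsub x x') by lra.
have := Rmult_le_compat_l (8 * C) _ _ ltac:(lra) H5.
by rewrite -Rmult_assoc Rinv_r; lra.
Qed.

(** * Blow-up where contact points are dense *)

Section Blowup.
Variables (F : mat N -> R) (s C d R0 m : R) (u v : vec N -> R).
Hypotheses (N0 : (0 < N)%N) (HF : elliptic F) (s0 : 0 < s) (C0 : 0 < C) (d0 : 0 < d) (m0 : 0 < m).
Hypotheses (Hu : semiconvex C u) (Hv : semiconvex C (fun y => - v y)).
Hypotheses (uu : usc u) (uv : usc (fun y => - v y)).
Hypothesis Hcontact : forall p, (forall i, Rabs (p i) <= d) -> exists x,
  [/\ forall i, Rabs (x i) <= R0, m <= u x - v x & contact (fun y => u y - v y) p x].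
Hypothesis Hsol : forall x, 0 < u x - v x ->
  subj F s everywhere u x /\ subj (dualF F) 0 everywhere (fun y => - v y) x.

Let A x := exists p, [/\ forall i, Rabs (p i) <= d, m <= u x - v x & contact (fun y => u y - v y) p x].

Lemma contact_set_dense : exists S, 0 < S /\ forall b, (1 < b)%N ->
  exists c' s', 0 < s' <= S /\ dense_in A c' s' (s' / INR b).
Proof.
have R00 : 0 <= R0.
  have [i|x [Hx _ _]] := Hcontact (p := vzero N); first by rewrite /vzero Rabs_R0; lra.
  by have := Hx (Ordinal N0); have := Rabs_pos (x (Ordinal N0)); lra.
have NR : 1 <= INR N by rewrite -INR_1; apply: le_INR; apply/leP.
exists (2 * R0 + 1); split; first lra.
move=> b b1.
pose X p := epsilon (inhabits (vzero N)) (fun x =>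
  [/\ forall i, Rabs (x i) <= R0, m <= u x - v x & contact (fun y => u y - v y) (ray (vzero N) d p) x]).
have sc p : (forall i, 0 <= p i <= 1) -> forall i, Rabs (ray (vzero N) d p i) <= d.
  by move=> Hp i; have := Hp i; rewrite /ray /vzero Rplus_0_l; split_Rabs; nra.
have HX p : (forall i, 0 <= p i <= 1) ->
  [/\ forall i, Rabs (X p i) <= R0, m <= u (X p) - v (X p) & contact (fun y => u y - v y) (ray (vzero N) d p) (X p)].
  by move=> /sc /Hcontact; apply: epsilon_spec.
(* Slopes are [d p] with [p] in the unit cube, hence the division by [d]. The factor [INR N] instead
   of its square root passes from the Euclidean to the sup norm. The extra 1 in the side makes the
   half-open cube contain all contact points. *)
apply: (@dense_cube N A (fun _ => - R0) (2 * R0 + 1) (4 * C * INR N / d) X b) => //.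
- lra.
- by apply: Rdiv_lt_0_compat => //; nra.
- move=> p Hp; have [H1 H2 H3] := HX p Hp; split.
    by exists (ray (vzero N) d p); split=> //; apply: sc.
  by move=> i; have := H1 i; split_Rabs; lra.
- move=> p q r Hp Hq r0 Hr i; have [_ _ H1] := HX p Hp; have [_ _ H2] := HX q Hq.
  have := contact_expansive C0 Hu Hv H1 H2.
  have -> : vsub (ray (vzero N) d p) (ray (vzero N) d q) = ray (vzero N) d (vsub p q).
    by apply: functional_extensionality => k; rewrite /ray /vsub /vzero; ring.
  have Hb : norm2 (vsub (X p) (X q)) <= INR N * (r * r).
    by apply: norm2_box => k; have := Hr k; rewrite /vsub; lra.
  rewrite norm2_ray0 => He; have Ht := norm2_term (vsub p q) i; rewrite {1 2}/vsub in Ht.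
  have {}He : d * d * ((p i - q i) * (p i - q i)) <= (4 * C * INR N * r) * (4 * C * INR N * r).
    have : d * d * ((p i - q i) * (p i - q i)) <= d * d * norm2 (vsub p q).
      by apply: Rmult_le_compat_l => //; nra.
    have : 16 * (C * C) * norm2 (vsub (X p) (X q)) <= 16 * (C * C) * (INR N * (r * r)).
      by apply: Rmult_le_compat_l => //; nra.
    have : INR N * (r * r) <= INR N * INR N * (r * r) by apply: Rmult_le_compat_r; nra.
    nra.
  have e0 : 0 < 4 * C * INR N * r by apply: Rmult_lt_0_compat => //; nra.
  have : d * Rabs (p i - q i) <= 4 * C * INR N * r.
    apply: Rsqr_incr_0_var; last lra.
    by rewrite /Rsqr; move: He; split_Rabs; nra.
  move=> H; apply: (Rmult_le_reg_l d) => //.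
  by have -> : d * (4 * C * INR N / d * r) = 4 * C * INR N * r by field; lra.
Qed.

(** With [k = n + 2], take a cube of side [s1] dense at scale [s1 / k^2] and rescale by
    [r = s1 / k]: the window has side [k] and the mesh is [1 / k]. The base point is a contact point
    close to the centre. *)
Lemma blowup_sequence : exists S, 0 < S /\ forall n, exists x r, [/\ A x, 0 < r <= S * / (INR n + 1)
  & forall a, (forall i, 2 * Rabs (a i) <= INR n) ->
     exists a', A (ray x r a') /\ forall i, Rabs (a' i - a i) <= / (INR n + 1)].
Proof.
have [S [S0 HS]] := contact_set_dense; exists S; split=> // n.
have [|c [s1 [s1S Hd]]] := HS (n.+2 * n.+2)%N; first by rewrite mulSn.
set k := INR n + 2; have n0 := pos_INR n.
have Ek : INR (n.+2 * n.+2)%N = k * k by rewrite mult_INR !S_INR /k; ring.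
rewrite Ek in Hd; have k2 : 2 <= k by rewrite /k; lra.
have ik : 0 < / k by apply: Rinv_0_lt_compat; lra.
have ikk : k * / k = 1 by field; lra.
pose o : vec N := fun i => c i + s1 / 2.
have [|x [Ax xo]] := Hd o; first by move=> i; rewrite /o; lra.
have E1 : s1 / (k * k) = s1 * / k * / k by field; lra.
rewrite E1 in Hd xo.
have sk : 0 < s1 * / k by nra.
have ik1 : / k <= / (INR n + 1) by apply: Rinv_le_contravar; rewrite /k; lra.
exists x, (s1 * / k); split=> //; first by split=> //; apply: Rmult_le_compat; lra.
move=> a Ha.
have [|x' [Ax' Hx']] := Hd (ray x (s1 * / k) a).
  move=> i; have := xo i; have := Ha i; rewrite /ray /o.
  have -> : s1 * / k * a i = s1 * (/ k * a i) by ring.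
  have -> : s1 * / k * / k = s1 * (/ k * / k) by ring.
  have -> : x i = c i + s1 * ((x i - c i) / s1) by field; lra.
  move: ((x i - c i) / s1) => X.
  have -> : c i + s1 * X - (c i + s1 / 2) = s1 * (X - / 2) by field.
  rewrite Rabs_mult (Rabs_pos_eq s1); last lra.
  move=> ha /Rmult_le_reg_l => /(_ ltac:(lra)) hX.
  have hh : Rabs (/ k * a i) <= (k - 2) / 2 * / k.
    rewrite Rabs_mult (Rabs_pos_eq (/ k)); last lra.
    by rewrite (Rmult_comm (/ k)); apply: Rmult_le_compat_r; [lra|rewrite /k; lra].
  have k3 : / k * / k <= / k / 2 by nra.
  suff : 0 <= s1 * (X + / k * a i) < s1 * 1 by lra.
  by split; [apply: Rmult_le_pos|apply: Rmult_lt_compat_l]; move: hX hh; split_Rabs; nra.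
exists (fun i => (x' i - x i) / (s1 * / k)); split.
  have -> // : ray x (s1 * / k) (fun i => (x' i - x i) / (s1 * / k)) = x'.
  by apply: functional_extensionality => i; rewrite /ray; field; lra.
move=> i; have := Hx' i; rewrite /ray.
have -> : x' i - (x i + s1 * / k * a i) = s1 * / k * ((x' i - x i) / (s1 * / k) - a i) by field; lra.
rewrite Rabs_mult (Rabs_pos_eq (s1 * / k)); last lra.
by move=> /Rmult_le_reg_l => /(_ sk); lra.
Qed.

Lemma semiconvex_comparison : False.
Proof.
have [S [S0 HS]] := blowup_sequence.
pose P n (t : vec N * R) := [/\ A t.1, 0 < t.2 <= S * / (INR n + 1)
  & forall a, (forall i, 2 * Rabs (a i) <= INR n) ->
     exists a', A (ray t.1 t.2 a') /\ forall i, Rabs (a' i - a i) <= / (INR n + 1)].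
pose T n := epsilon (inhabits (vzero N, 0)) (P n).
have HT n : P n (T n) by apply: epsilon_spec; have [x [r ?]] := HS n; exists (x, r).
pose X n := (T n).1; pose r n := (T n).2.
have AX n : A (X n) by case: (HT n).
have r0 n : 0 < r n by case: (HT n) => _ [].
have rS n : r n <= S * / (INR n + 1) by case: (HT n) => _ [].
have pin x : A x -> exists zz : vec N * vec N, pinned C u x zz.1 /\ pinned C v x zz.2.
  by move=> [p [_ _ Hp]]; have [z1 [z2 H]] := contact_pinned Hu Hv Hp; exists (z1, z2).
pose zz x := epsilon (inhabits (vzero N, vzero N)) (fun zz => pinned C u x zz.1 /\ pinned C v x zz.2).
have Hzz x : A x -> pinned C u x (zz x).1 /\ pinned C v x (zz x).2.
  by move=> /pin; apply: epsilon_spec.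
pose U n := zoom u (X n) (zz (X n)).1 (r n).
pose V n := zoom v (X n) (zz (X n)).2 (r n).
have bU n y : Rabs (U n y) <= C * norm2 y by apply: pinned_zoom_bound => //; case: (Hzz _ (AX n)).
have bV n y : Rabs (V n y) <= C * norm2 y by apply: pinned_zoom_bound => //; case: (Hzz _ (AX n)).
have dens a : exists an, vcv an a /\ om (fun n => A (ray (X n) (r n) (an n))).
  have Hn : om (fun n => forall i, 2 * Rabs (a i) <= INR n).
    apply: om_ord => i; have [k Hk] := INR_unbounded (2 * Rabs (a i)).
    by apply: om_mono (om_ge k) _ => n /leP /le_INR; lra.
  pose an n := epsilon (inhabits a) (fun a' => A (ray (X n) (r n) a') /\ forall i, Rabs (a' i - a i) <= / (INR n + 1)).
  have Han : om (fun n => A (ray (X n) (r n) (an n)) /\ forall i, Rabs (an n i - a i) <= / (INR n + 1)).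
    apply: om_mono Hn _ => n Hn; have [_ _ H] := HT n; exact: (epsilon_spec _ _ (H a Hn)).
  exists an; split; last by apply: om_mono Han _ => n [].
  move=> i; have H0 : ucv (fun n => an n i - a i) 0.
    by apply: ucv_squeeze0 ucv_inv; apply: om_mono Han _ => n [_ /(_ i)].
  have := ucv_plus H0 (ucv_const (a i)); rewrite Rplus_0_l.
  by apply: ucv_eq; apply: om_all => n; ring.
have apU : asymptotically_pinned C U.
  split=> // a; have [an [Ha HA]] := dens a; eexists; eexists; split; first exact: Ha.
  apply: om_mono HA _ => n HA; apply: pinned_zoom => //; exact: (proj1 (Hzz _ HA)).
have apV : asymptotically_pinned C V.
  split=> // a; have [an [Ha HA]] := dens a; eexists; eexists; split; first exact: Ha.
  apply: om_mono HA _ => n HA; apply: pinned_zoom => //; exact: (proj2 (Hzz _ HA)).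
have [Ul HU] := pointwise_limit (B := fun y => C * norm2 y) (fun y => om_all (fun n => bU n y)).
have [Vl HV] := pointwise_limit (B := fun y => C * norm2 y) (fun y => om_all (fun n => bV n y)).
have [pU cU] := asymptotically_pinned_limit apU HU.
have [pV cV] := asymptotically_pinned_limit apV HV.
have NR : 0 <= INR N by apply: pos_INR.
(* The equations hold only where [u > v]. At the base points the difference is at least [m], and
   [contact_lower] keeps it positive nearby because [r n] tends to 0. *)
have posw Y a : vcv Y a -> om (fun n => 0 < u (ray (X n) (r n) (Y n)) - v (ray (X n) (r n) (Y n))).
  move=> HY; pose t n := S * / (INR n + 1).
  have ht : ucv t 0 by rewrite -(Rmult_0_r S); apply: ucv_scal; exact: ucv_inv.
  have HB : om (fun n => norm2 (Y n) <= norm2 a + 1) := vcv_norm2_bounded HY.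
  have h1 : ucv (fun n => t n * ((norm2 a + 1 + INR N * (d * d)) / 2)) 0.
    by have := ucv_mult ht (ucv_const ((norm2 a + 1 + INR N * (d * d)) / 2)); rewrite Rmult_0_l.
  have h2 : ucv (fun n => 2 * C * (t n * t n * (norm2 a + 1))) 0.
    have := ucv_scal (2 * C) (ucv_mult (ucv_mult ht ht) (ucv_const (norm2 a + 1))).
    by rewrite !Rmult_0_l Rmult_0_r.
  have h3 := ucv_plus h1 h2; rewrite Rplus_0_r in h3.
  apply: om_mono2 HB (ucv_lt h3 m0) _ => n nb.
  have [p [Hp mX Hc]] := AX n; have := contact_lower (ray (X n) (r n) (Y n)) Hu Hv Hc.
  rewrite vsub_ray dot_ray0 norm2_ray0.
  have tn : 0 < r n <= t n by have := r0 n; have := rS n; rewrite /t; lra.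
  have := young p (Y n); have := norm2_box Hp; have := norm2_ge0 (Y n).
  move: (dot p _) (norm2 (Y n)) (norm2 p) nb => D Q Pn nb Q0 Pb yg.
  have D1 : - ((norm2 a + 1 + INR N * (d * d)) / 2) <= D by move: yg; split_Rabs; lra.
  have M0 : 0 <= (norm2 a + 1 + INR N * (d * d)) / 2 by have := norm2_ge0 a; nra.
  have D2 : - (t n * ((norm2 a + 1 + INR N * (d * d)) / 2)) <= r n * D by nra.
  have Q1 : r n * r n * Q <= t n * t n * (norm2 a + 1).
    by apply: Rmult_le_compat; nra.
  have Q2 : 2 * C * (r n * r n * Q) <= 2 * C * (t n * t n * (norm2 a + 1)).
    by apply: Rmult_le_compat_l; lra.
  lra.
(* The planes touching at the anchors have bounded slopes and pass to the limit. *)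
have convex a : exists q, forall y, Ul y - Vl y <= Ul a - Vl a + dot q (vsub y a).
  have [an [Ha HA]] := dens a.
  have Hq : om (fun n => exists q, contact (fun y => U n y - V n y) q (an n)).
    apply: om_mono HA _ => n [p [_ _ Hp]].
    (* The slope [p], corrected by the affine parts removed in both zooms, divided by [r n]. *)
    exists (ray (ray (ray (vzero N) (/ r n) p) (- / r n) (zz (X n)).1) (/ r n) (zz (X n)).2) => y.
    have := Hp (ray (X n) (r n) y); rewrite /U /V /zoom.
    have -> : vsub (ray (X n) (r n) y) (ray (X n) (r n) (an n)) = ray (vzero N) (r n) (vsub y (an n)).
      by apply: functional_extensionality => i; rewrite /ray /vsub /vzero; ring.
    rewrite dot_ray0 !dot_rayl dot_0l !dot_sub => H.
    have rp := r0 n; have rr : 0 < r n * r n by nra.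
    apply: (Rmult_le_reg_r (r n * r n)) => //; rewrite /Rdiv.
    move: (r n) rp rr H => rn rp rr H.
    have E (c : R) : c * / (rn * rn) * (rn * rn) = c by field; lra.
    have E' (c : R) : / rn * c * (rn * rn) = rn * c by field; lra.
    have E2 (c : R) : - / rn * c * (rn * rn) = - (rn * c) by field; lra.
    rewrite !(Rmult_plus_distr_r, Rmult_minus_distr_r) !E.
    rewrite !(Rmult_minus_distr_l, Rmult_plus_distr_l) !(Rmult_plus_distr_r, Rmult_minus_distr_r) !E' !E2.
    lra.
  pose q n := epsilon (inhabits a) (fun q => contact (fun y => U n y - V n y) q (an n)).
  have {}Hq : om (fun n => contact (fun y => U n y - V n y) (q n) (an n)).
    by apply: om_mono Hq _ => n; apply: epsilon_spec.
  have [ql Hql] : exists ql, vcv q ql.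
    apply: (@vcv_box _ _ (2 * C * (3 * (norm2 a + 1) + 2))).
    apply: om_mono2 Hq (vcv_norm2_bounded Ha) _ => n Hc Hb i.
    have := Hc (ray (an n) 1 (ebasis i)); have := Hc (ray (an n) (-1) (ebasis i)).
    rewrite !vsub_ray !dot_ray0 !dot_ebasis.
    have := norm2_ray_le (an n) 1 (ebasis i); have := norm2_ray_le (an n) (-1) (ebasis i).
    rewrite norm2_ebasis.
    have := bU n (an n); have := bV n (an n).
    have := bU n (ray (an n) 1 (ebasis i)); have := bV n (ray (an n) 1 (ebasis i)).
    have := bU n (ray (an n) (-1) (ebasis i)); have := bV n (ray (an n) (-1) (ebasis i)).
    move: (norm2 (ray _ 1 _)) (norm2 (ray _ (-1) _)) (U n _) (V n _) (U n _) (V n _) (U n _) (V n _).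
    move=> n1 n2 u1 v1 u2 v2 u3 v3; split_Rabs; nra.
  exists ql => y.
  have Hs : vcv (fun n => vsub y (an n)) (vsub y a) by apply: vcv_sub => //; apply: vcv_const.
  apply: ucv_le _ (ucv_minus (HU y) (HV y)) (ucv_plus (ucv_minus (cU _ _ Ha) (cV _ _ Ha)) (ucv_dot Hql Hs)).
  by apply: om_mono Hq _ => n; apply.
apply: (@smooth_solution_absurd N F s C Vl) => //.
- move=> y; have H := HV y; apply: Rabs_le.
  by split; [apply: ucv_le _ (ucv_const _) H | apply: ucv_le _ H (ucv_const _)];
    apply: om_all => n; have := bV n y; split_Rabs; lra.
(* A test polynomial above [Vl] plus the affine function above [Ul - Vl] tests [Ul] with the same
   Hessian; thus [Vl] inherits the subsolution inequality. *)
- move=> a p B e e0 Ht; have [q Hq] := convex a.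
  have subU : subj F s everywhere Ul a.
    apply: (subj_stable HF cU) => [n|Y HY]; first exact: usc_zoom.
    by apply: om_mono (posw Y a HY) _ => n /Hsol [H _]; apply: subj_zoom.
  apply: (subU (ray p 1 q) B e) => // y Iy ny.
  have := Ht y Iy ny; have := Hq y; rewrite dot_rayl; lra.
- move=> a; apply: (subj_stable (elliptic_dual HF) (Un := fun n y => - V n y)).
  + by move=> Y y HY; apply/ucv_opp/cV.
  + by move=> n; rewrite zoom_opp; apply: usc_zoom.
  + move=> Y HY; apply: om_mono (posw Y a HY) _ => n /Hsol [_ H].
    by rewrite /V zoom_opp; apply: subj_zoom.
Qed.

End Blowup.

End SemiconvexComparison.

(** * Sup-convolutions and the comparison principle *)

Section Comparison.
Variable N : nat.
Implicit Types (S Om : vec N -> Prop) (f u v z : vec N -> R) (x y p : vec N).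

(** * Compactness on the closure of a bounded set *)

Lemma closure_vcv S X x : om (fun n => closure S (X n)) -> vcv X x -> closure S x.
Proof.
move=> H HX r r0.
have [n [Hn cn]] := om_ex (om_and (vcv_near HX (r := r/2) ltac:(lra)) H).
have [y [Sy ny]] := cn (r/2) ltac:(lra); exists y; split=> // i.
by have := Hn i; have := ny i; split_Rabs; lra.
Qed.

Lemma subset_closure S x : S x -> closure S x.
Proof. by move=> Sx r r0; exists x; split=> // i; rewrite Rminus_diag Rabs_R0. Qed.

Lemma cont_on_ucv S f X x : cont_on S f -> S x -> om (fun n => S (X n)) -> vcv X x ->
  ucv (fun n => f (X n)) (f x).
Proof.
move=> Hf Sx HS HX e e0; have [d [d0 Hd]] := Hf x Sx e e0.
by apply: om_mono2 HS (vcv_near HX d0) _ => n; apply: Hd.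
Qed.

Lemma closure_bounded S : is_bounded S -> exists M, 0 <= M /\ forall x, closure S x -> norm2 x <= M.
Proof.
move=> [M HM]; exists (INR N * ((Rabs M + 1) * (Rabs M + 1))); split.
  by apply: Rmult_le_pos; [apply: pos_INR|have := Rabs_pos M; nra].
move=> x cx; apply: norm2_box => i; have [y [Sy ny]] := cx 1 ltac:(lra).
by have := HM y Sy i; have := ny i; split_Rabs; lra.
Qed.

Lemma closure_argmax S f x0 : is_bounded S -> cont_on (closure S) f -> closure S x0 ->
  exists x, closure S x /\ forall y, closure S y -> f y <= f x.
Proof.
move=> /closure_bounded [M [_ HM]] Hf S0; apply: (argmax (x0 := x0) (K := M)) => //.
- by move=> x Sx _; apply: HM.
- by move=> X x SX _; apply: closure_vcv; apply: om_all.
- move=> x Sx X SX HX e e0; apply: ucv_lt (cont_on_ucv Hf Sx _ HX) _; [exact: om_all|lra].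
Qed.

Lemma bounded_on_closure S f : is_bounded S -> cont_on (closure S) f ->
  exists B, 0 <= B /\ forall x, closure S x -> Rabs (f x) <= B.
Proof.
move=> bS Hf; case: (classic (exists x, closure S x)) => [[x0 S0]|nS]; last first.
  by exists 0; split=> [|x Sx]; [lra|case: nS; exists x].
have [x [Sx Hx]] := closure_argmax bS Hf S0.
have Hg : cont_on (closure S) (fun y => - f y).
  move=> y Sy e e0; have [d [d0 Hd]] := Hf y Sy e e0; exists d; split=> // y' Sy' ny.
  by have := Hd y' Sy' ny; split_Rabs; lra.
have [y [Sy Hy]] := closure_argmax bS Hg S0.
exists (Rabs (f x) + Rabs (f y)); split; first by have := Rabs_pos (f x); have := Rabs_pos (f y); lra.
by move=> t St; have := Hx t St; have := Hy t St; split_Rabs; lra.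
Qed.

Lemma vcv_cont_on S g : (forall X x, (forall n, closure S (X n)) -> closure S x -> vcv X x ->
  ucv (fun n => g (X n)) (g x)) -> cont_on (closure S) g.
Proof.
move=> H x Sx e e0; apply: NNPP => nd.
have step n : exists y, closure S y /\ near x (/ (INR n + 1)) y /\ e <= Rabs (g y - g x).
  apply: NNPP => ny; apply: nd; exists (/ (INR n + 1)); split.
    by apply: Rinv_0_lt_compat; have := pos_INR n; lra.
  by move=> y Sy nxy; apply: Rnot_le_lt => He; apply: ny; exists y.
pose X n := epsilon (inhabits x) (fun y => closure S y /\ near x (/ (INR n + 1)) y /\ e <= Rabs (g y - g x)).
have HX n : closure S (X n) /\ near x (/ (INR n + 1)) (X n) /\ e <= Rabs (g (X n) - g x) := epsilon_spec _ _ (step n).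
have Xx : vcv X x.
  move=> i d d0; apply: om_mono (ucv_inv d0) _ => n; rewrite Rminus_0_r => Hd.
  have [_ [/(_ i) Hn _]] := HX n; have := Rle_abs (/ (INR n + 1)); lra.
have [n Hn] := om_ex (H X x (fun n => proj1 (HX n)) Sx Xx e e0).
by have [_ [_ ?]] := HX n; lra.
Qed.

(** Here [u x] is the maximum over [y] of [f y - k |x - y|^2], attained at [Y x]. As a maximum of
    paraboloids of one opening it is semiconvex, and a test function at [x], translated to [Y x],
    tests [f] there. *)
Lemma sup_convolution Om f (k : R) : 0 < k -> (exists x, Om x) -> is_bounded Om ->
  cont_on (closure Om) f -> exists u (Y : vec N -> vec N),
  [/\ forall x, closure Om (Y x) /\ u x = f (Y x) - k * norm2 (vsub x (Y x)),
      forall x, closure Om x -> f x <= u x,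
      semiconvex k u, usc u
    & forall (F : mat N -> R) s x, is_open Om -> Om (Y x) -> subj F s Om f (Y x) -> subj F s everywhere u x].
Proof.
move=> k0 [o Oo] bO Hf; have Co := subset_closure Oo.
have am x : exists y, closure Om y /\ forall t, closure Om t ->
    f t - k * norm2 (vsub x t) <= f y - k * norm2 (vsub x y).
  apply: (closure_argmax (f := fun t => f t - k * norm2 (vsub x t)) bO _ Co).
  apply: vcv_cont_on => X y SX Sy HX; apply: ucv_minus.
    exact: cont_on_ucv Hf Sy (om_all SX) HX.
  by apply: ucv_scal; apply: ucv_norm2; apply: vcv_sub => //; apply: vcv_const.
pose Y x := epsilon (inhabits o) (fun y => closure Om y /\ forall t, closure Om t ->
    f t - k * norm2 (vsub x t) <= f y - k * norm2 (vsub x y)).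
have HY x : closure Om (Y x) /\ forall t, closure Om t ->
    f t - k * norm2 (vsub x t) <= f (Y x) - k * norm2 (vsub x (Y x)) := epsilon_spec _ _ (am x).
have [M [M0 HM]] := closure_bounded bO.
exists (fun x => f (Y x) - k * norm2 (vsub x (Y x))), Y; split.
- by move=> x; split=> //; case: (HY x).
- by move=> x Sx; have [_ /(_ x Sx)] := HY x; rewrite vsub_self norm2_0; lra.
- move=> x; exists (ray (vzero N) (- 2 * k) (vsub x (Y x))) => y.
  have [Sx _] := HY x; have [_ /(_ _ Sx)] := HY y; rewrite (dotC (ray _ _ _)) dot_ray0.
  rewrite dot_subl !dot_sub dot_norm2 !norm2_sub (dotC y x); lra.
- move=> x X _ HX e e0.
  have H1 : ucv (fun n => norm2 (X n) - norm2 x) 0.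
    by rewrite -(Rminus_diag (norm2 x)); apply: ucv_minus (ucv_const _); apply: ucv_norm2.
  have H2 : ucv (fun n => dot (Y (X n)) (vsub (X n) x)) 0.
    apply: (@ucv_dot0 _ _ _ (M + 1)).
      apply: om_all => n i; have [Sn _] := HY (X n); have := HM _ Sn.
      by have := norm2_term (Y (X n)) i; split_Rabs; nra.
    by rewrite -(vsub_self x); apply: vcv_sub => //; apply: vcv_const.
  have := ucv_scal k (ucv_minus (ucv_scal 2 H2) H1); rewrite !Rmult_0_r Rminus_0_r Rmult_0_r => /ucv_lt /(_ e0).
  move=> H3; apply: om_mono H3 _ => n.
  have [Sn _] := HY (X n); have [_ /(_ _ Sn)] := HY x.
  rewrite !norm2_sub dot_sub (dotC _ (X n)) (dotC _ x); lra.
- move=> F s x oO Ox sub p A r r0 Ht; apply: (sub p A r r0) => y Oy ny.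
  (* Moving [y] by [x - Y x] leaves the penalty unchanged, so it cancels. *)
  pose y' := ray y 1 (vsub x (Y x)).
  have E1 : vsub y' y = vsub x (Y x).
    by apply: functional_extensionality => i; rewrite /y' /ray /vsub; ring.
  have E2 : vsub y' x = vsub y (Y x).
    by apply: functional_extensionality => i; rewrite /y' /ray /vsub; ring.
  have ny' : near x r y'.
    by move=> i; have := ny i; rewrite /y' /ray /vsub; split_Rabs; lra.
  have := Ht y' I ny'; rewrite E2; have [_ /(_ y (subset_closure Oy))] := HY y'.
  rewrite E1; lra.
Qed.

Lemma dot_le_box x y (a b : R) : (forall i, Rabs (x i) <= a) -> (forall i, Rabs (y i) <= b) ->
  Rabs (dot x y) <= INR N * (a * b).
Proof.
move=> Hx Hy; rewrite -sumR_const.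
have T i : Rabs (x i * y i) <= a * b.
  by rewrite Rabs_mult; apply: Rmult_le_compat; [exact: Rabs_pos|exact: Rabs_pos|exact: Hx|exact: Hy].
apply: Rabs_le; split.
  rewrite -(Rmult_1_l (sumR _)) Ropp_mult_distr_l -sumR_scal; apply: sumR_le => i.
  by have := T i; split_Rabs; lra.
by apply: sumR_le => i; have := T i; split_Rabs; lra.
Qed.

(** The gap [tau] on the boundary keeps the points where the sup-convolutions take their values
    inside [Om] as soon as their sum is positive and the penalty is large, so that the equations can
    be transported. *)
Lemma comparison_gap Om (F : mat N -> R) (s tau : R) f z :
  (0 < N)%N -> is_open Om -> is_bounded Om -> elliptic F -> 0 < s -> 0 < tau ->
  cont_on (closure Om) f -> cont_on (closure Om) z ->
  (forall x, boundary Om x -> f x <= z x - tau) ->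
  (forall x, Om x -> z x - tau < f x -> subj F s Om f x) ->
  (forall x, Om x -> subj (dualF F) 0 Om (fun y => - z y) x) ->
  forall x, Om x -> f x <= z x.
Proof.
move=> N0 oO bO HF s0 tau0 Hf Hz bnd sub sup x0 O0; apply: Rnot_lt_le => m0.
have Hz' : cont_on (closure Om) (fun y => - z y).
  move=> y Sy e e0; have [d [d0 Hd]] := Hz y Sy e e0; exists d; split=> // y' Sy' ny.
  by have := Hd y' Sy' ny; split_Rabs; lra.
have [M [M0 HM]] := closure_bounded bO.
have [Bf [Bf0 HBf]] := bounded_on_closure bO Hf.
have [Bz [Bz0 HBz]] := bounded_on_closure bO Hz.
(* A penalty of at least 2 leaves quadratic decay after the linear tilts below. *)
have kp n : 0 < INR n + 2 by have := pos_INR n; lra.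
(* If every [n] failed, the two maximisers would converge to one point where [f >= z]. The gap
   places it in [Om], so both maximisers would finally lie in [Om] with [f > z - tau], a
   contradiction. *)
have [n [uf [Yf [uz [Yz [[Hf1 Hf2 Hf3 Hf4 Hf5] [Hz1 Hz2 Hz3 Hz4 Hz5] Hloc]]]]]] : exists n uf Yf uz Yz,
  [/\ [/\ forall x, closure Om (Yf x) /\ uf x = f (Yf x) - (INR n + 2) * norm2 (vsub x (Yf x)),
      forall x, closure Om x -> f x <= uf x, semiconvex (INR n + 2) uf, usc uf
    & forall (F : mat N -> R) s x, is_open Om -> Om (Yf x) -> subj F s Om f (Yf x) -> subj F s everywhere uf x],
  [/\ forall x, closure Om (Yz x) /\ uz x = - z (Yz x) - (INR n + 2) * norm2 (vsub x (Yz x)),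
      forall x, closure Om x -> - z x <= uz x, semiconvex (INR n + 2) uz, usc uz
    & forall (F : mat N -> R) s x, is_open Om -> Om (Yz x) -> subj F s Om (fun y => - z y) (Yz x) -> subj F s everywhere uz x]
  & forall x, 0 < uf x + uz x -> [/\ Om (Yf x), z (Yf x) - tau < f (Yf x) & Om (Yz x)]].
  apply: NNPP => nex.
  have step n : exists t : vec N * vec N * vec N, [/\ closure Om t.1.2, closure Om t.2,
      0 < f t.1.2 - z t.2 - (INR n + 2) * (norm2 (vsub t.1.1 t.1.2) + norm2 (vsub t.1.1 t.2))
    & ~ [/\ Om t.1.2, z t.1.2 - tau < f t.1.2 & Om t.2]].
    have [uf [Yf Pf]] := sup_convolution (kp n) (ex_intro _ x0 O0) bO Hf.
    have [uz [Yz Pz]] := sup_convolution (kp n) (ex_intro _ x0 O0) bO Hz'.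
    apply: NNPP => nt; apply: nex; exists n, uf, Yf, uz, Yz; split=> // x Hx.
    apply: NNPP => nx; apply: nt; exists (x, Yf x, Yz x) => /=.
    case: Pf => /(_ x) [? Ef] _ _ _ _; case: Pz => /(_ x) [? Ez] _ _ _ _; split=> //.
    by move: Hx; rewrite Ef Ez; lra.
  pose T n := epsilon (inhabits (x0, x0, x0)) (fun t : vec N * vec N * vec N => [/\ closure Om t.1.2, closure Om t.2,
      0 < f t.1.2 - z t.2 - (INR n + 2) * (norm2 (vsub t.1.1 t.1.2) + norm2 (vsub t.1.1 t.2))
    & ~ [/\ Om t.1.2, z t.1.2 - tau < f t.1.2 & Om t.2]]).
  have HT n : [/\ closure Om (T n).1.2, closure Om (T n).2,
      0 < f (T n).1.2 - z (T n).2 - (INR n + 2) * (norm2 (vsub (T n).1.1 (T n).1.2) + norm2 (vsub (T n).1.1 (T n).2))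
    & ~ [/\ Om (T n).1.2, z (T n).1.2 - tau < f (T n).1.2 & Om (T n).2]] := epsilon_spec _ _ (step n).
  have [Y HY] : exists Y, vcv (fun n => (T n).1.2) Y.
    by apply: (@vcv_bounded _ _ M); apply: om_all => n; apply: HM; case: (HT n).
  have H0 : ucv (fun n => (Bf + Bz) * / (INR n + 1)) 0.
    by rewrite -(Rmult_0_r (Bf + Bz)); apply: ucv_scal; exact: ucv_inv.
  have small n : norm2 (vsub (T n).1.1 (T n).1.2) + norm2 (vsub (T n).1.1 (T n).2) <= (Bf + Bz) * / (INR n + 1).
    have [C1 C2 Hp _] := HT n; have := HBf _ C1; have := HBz _ C2; have n0 := pos_INR n.
    have := norm2_ge0 (vsub (T n).1.1 (T n).1.2); have := norm2_ge0 (vsub (T n).1.1 (T n).2).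
    move=> a0 b0 h1 h2; apply: (Rmult_le_reg_r (INR n + 1)); first lra.
    rewrite Rmult_assoc Rinv_l; last lra.
    by move: h1 h2 Hp; split_Rabs; nra.
  have HX : vcv (fun n => (T n).1.1) Y.
    apply: (vcv_dist2 HY); apply: ucv_squeeze0 H0; apply: om_all => n.
    rewrite Rabs_pos_eq; last exact: norm2_ge0.
    by have := small n; have := norm2_ge0 (vsub (T n).1.1 (T n).2); lra.
  have HZ : vcv (fun n => (T n).2) Y.
    apply: (vcv_dist2 HX); apply: ucv_squeeze0 H0; apply: om_all => n.
    rewrite Rabs_pos_eq; last exact: norm2_ge0.
    by rewrite norm2_subC; have := small n; have := norm2_ge0 (vsub (T n).1.1 (T n).1.2); lra.
  have C1 : om (fun n => closure Om (T n).1.2) by apply: om_all => n; case: (HT n).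
  have C2 : om (fun n => closure Om (T n).2) by apply: om_all => n; case: (HT n).
  have CY : closure Om Y by apply: closure_vcv C1 HY.
  have fY := cont_on_ucv Hf CY C1 HY; have zY := cont_on_ucv Hz CY C1 HY.
  have zZ := cont_on_ucv Hz CY C2 HZ.
  have fz : 0 <= f Y - z Y.
    apply: ucv_le _ (ucv_const 0) (ucv_minus fY zZ); apply: om_all => n.
    have [_ _ Hp _] := HT n; have := norm2_ge0 (vsub (T n).1.1 (T n).1.2); have := norm2_ge0 (vsub (T n).1.1 (T n).2).
    by have := pos_INR n; nra.
  have OY : Om Y by apply: NNPP => nO; have := bnd Y (conj CY nO); lra.
  have [r [r0 Hr]] := oO Y OY.
  have K3 := ucv_gt (ucv_minus fY zY) (c := - tau) ltac:(lra).
  have [n [[K1 K2] K4]] := om_ex (om_and (om_and (vcv_near HY r0) (vcv_near HZ r0)) K3).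
  by have [_ _ _] := HT n; apply; split; [exact: Hr|lra|exact: Hr].
set k := INR n + 2 in Hf1 Hf3 Hz1 Hz3; have k2 : 2 <= k by rewrite /k; have := pos_INR n; lra.
set m := f x0 - z x0; have mp : 0 < m by rewrite /m; lra.
have w0 : m <= uf x0 + uz x0.
  by have := Hf2 x0 (subset_closure O0); have := Hz2 x0 (subset_closure O0); rewrite /m; lra.
have wbd y : uf y + uz y <= Bf + Bz + 2 * k * M - k * norm2 y.
  have [C1 ->] := Hf1 y; have [C2 ->] := Hz1 y.
  have := HBf _ C1; have := HBz _ C2; have := HM _ C1; have := HM _ C2.
  have := norm2_ray_le (vsub y (Yf y)) 1 (Yf y); have := norm2_ray_le (vsub y (Yz y)) 1 (Yz y).
  have R1 t : ray (vsub y t) 1 t = y by apply: functional_extensionality => i; rewrite /ray /vsub; ring.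
  rewrite !R1 => h1 h2 h3 h4.
  have h5 : norm2 y <= norm2 (vsub y (Yf y)) + norm2 (vsub y (Yz y)) + 2 * M by lra.
  have := Rmult_le_compat_l k _ _ ltac:(lra) h5; split_Rabs; lra.
have N0' := pos_INR N.
(* For tilts with coordinates at most 1, Young's inequality bounds the tilted sum by
   [K1 - |y|^2]. *)
set K1 := Bf + Bz + 2 * k * M + INR N + norm2 x0.
have K10 : 0 <= K1 by have := norm2_ge0 x0; rewrite /K1; nra.
set E := 2 * K1 + 2.
have NE : 0 < 2 * (INR N + 1) * E by rewrite /E; nra.
(* [E] bounds the coordinates of [x - x0] for the maximisers, so a tilt by at most [d] lowers the
   value at the maximum by no more than [m / 2]. *)
set d := Rmin 1 (m / (2 * (INR N + 1) * E)).
have d0 : 0 < d by apply: Rmin_pos; [lra|apply: Rdiv_lt_0_compat].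
have d1 : d <= 1 by apply: Rmin_l.
have dE : INR N * (d * E) <= m / 2.
  have : d <= m / (2 * (INR N + 1) * E) by apply: Rmin_r.
  move=> /(Rmult_le_compat_r ((INR N + 1) * E) _ _ ltac:(rewrite /E; nra)).
  have -> : m / (2 * (INR N + 1) * E) * ((INR N + 1) * E) = m / 2 by field; rewrite /E; lra.
  have h : 0 <= d * E by apply: Rmult_le_pos; rewrite /E; lra.
  lra.
have EE : (fun y => - - uz y) = uz by apply: functional_extensionality => y; ring.
apply: (@semiconvex_comparison N F s k d (K1 + 1) (m / 2) uf (fun y => - uz y)) => //; rewrite ?EE //; try lra.
- move=> p Hp.
  have pb y : uf y + uz y - dot p (vsub y x0) <= K1 - norm2 y.
    have := young p (vsub y x0); have := norm2_sub_le y x0; have := wbd y.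
    have Hp1 : norm2 p <= INR N * (1 * 1) by apply: norm2_box => i; have := Hp i; lra.
    by have := norm2_ge0 y; rewrite /K1; split_Rabs; nra.
  have [||||x [_ Hx]] := @argmax N everywhere (fun y => uf y + uz y - dot p (vsub y x0)) x0 K1.
  + by [].
  + by move=> y _; have := pb y; rewrite vsub_self dot_0r; lra.
  + by [].
  + move=> y _ X _ HX e e0.
    have H1 := Hf4 y X (fun=> I) HX (e/3) ltac:(lra).
    have H2 := Hz4 y X (fun=> I) HX (e/3) ltac:(lra).
    have H3 := ucv_gt (ucv_dot (vcv_const p) (vcv_sub HX (vcv_const x0))) (c := dot p (vsub y x0) - e/3) ltac:(lra).
    by apply: om_mono3 H1 H2 H3 _ => j; lra.
  have wx := Hx x0 I; rewrite vsub_self dot_0r in wx.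
  have xb := pb x; have nx : norm2 x <= K1 by lra.
  have xi i : Rabs (x i) <= K1 + 1 by have := norm2_term x i; split_Rabs; nra.
  have x0i i : Rabs (x0 i) <= K1 + 1.
    have : norm2 x0 <= K1 by rewrite /K1; nra.
    by have := norm2_term x0 i; split_Rabs; nra.
  exists x; split=> //.
    have : Rabs (dot p (vsub x x0)) <= INR N * (d * E).
      by apply: dot_le_box => // i; have := xi i; have := x0i i; rewrite /vsub /E; split_Rabs; lra.
    by split_Rabs; lra.
  by move=> y; have := Hx y I; rewrite !dot_sub; lra.
- move=> x; rewrite /Rminus Ropp_involutive => /Hloc [O1 fz O2]; split; first by apply: Hf5 => //; apply: sub.
  by apply: Hz5 => //; apply: sup.
Qed.

Lemma subj_shift (F : mat N -> R) s S f c x : subj F s S f x -> subj F s S (fun y => f y + c) x.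
Proof. by move=> H p A r r0 Ht; apply: (H p A r r0) => y Sy ny; have := Ht y Sy ny; lra. Qed.

(** Raising [z] by [tau] opens the gap on the boundary and keeps the inequalities; then [tau] tends
    to 0. *)
Theorem comparison Om (F : mat N -> R) (s : R) f z :
  (0 < N)%N -> is_open Om -> is_bounded Om -> elliptic F -> 0 < s ->
  cont_on (closure Om) f -> cont_on (closure Om) z ->
  (forall x, boundary Om x -> f x <= z x) ->
  (forall x, Om x -> z x < f x -> subj F s Om f x) ->
  (forall x, Om x -> subj (dualF F) 0 Om (fun y => - z y) x) ->
  forall x, Om x -> f x <= z x.
Proof.
move=> N0 oO bO HF s0 Hf Hz bnd sub sup x Ox.
suff K tau : 0 < tau -> f x <= z x + tau.
  by apply: Rnot_lt_le => Hlt; have := K ((f x - z x) / 2) ltac:(lra); lra.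
move=> tau0; apply: (@comparison_gap Om F s tau f (fun y => z y + tau)) => //.
- move=> y Sy e e0; have [d [d0 Hd]] := Hz y Sy e e0; exists d; split=> // y' Sy' ny.
  by have := Hd y' Sy' ny; split_Rabs; lra.
- by move=> y /bnd; lra.
- by move=> y Oy h; apply: sub => //; lra.
- move=> y Oy; have -> : (fun y => - (z y + tau)) = (fun y => - z y + - tau).
    by apply: functional_extensionality => t; ring.
  exact/subj_shift/sup.
Qed.

End Comparison.

(** * The operators [lambda j] *)

Lemma Rsup_lub (E : R -> Prop) : (exists x, E x) -> bound E -> is_lub E (Rsup E).
Proof.
move=> nE bE; have [l Hl] := completeness E bE nE.
by apply: (epsilon_spec (inhabits 0) (fun l => is_lub E l)); exists l.
Qed.

Section Lambda.
Variables (N j : nat).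
Hypothesis jN : (1 <= j <= N)%N.
Implicit Types (A B : mat N) (vs : 'I_j -> vec N).

Let Q A vs : R -> Prop := fun q => exists v, in_span vs v /\ norm2 v = 1 /\ q = quad A v.

Lemma unit_vector_in_span vs : lin_indep vs -> exists v, in_span vs v /\ norm2 v = 1.
Proof.
move=> li; have j0 : (0 < j)%N by case/andP: jN.
pose i0 := Ordinal j0.
have lc t : lin_comb vs (fun i => t * ebasis i0 i) = ray (vzero N) t (vs i0).
  apply: functional_extensionality => k; rewrite /lin_comb /ray /vzero Rplus_0_l.
  rewrite -(sumR_delta (fun i => t * vs i k) i0); apply: sumR_ext => i; ring.
have n0 : 0 < norm2 (vs i0).
  have := norm2_ge0 (vs i0); case=> // /esym /norm2_eq0 E.
  have := li (fun i => 1 * ebasis i0 i) _ i0; rewrite /ebasis eqxx Rmult_1_r => H.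
  have : 1 = 0; last lra.
  by apply: H => k; rewrite lc E /ray /vzero; ring.
have sp := sqrt_lt_R0 _ n0; have sE := sqrt_sqrt _ (Rlt_le _ _ n0).
exists (ray (vzero N) (/ sqrt (norm2 (vs i0))) (vs i0)); split.
  by exists (fun i => / sqrt (norm2 (vs i0)) * ebasis i0 i).
by rewrite norm2_ray0 -{3}sE; field; lra.
Qed.

Lemma Q_lub A vs : lin_indep vs -> is_lub (Q A vs) (Rsup (Q A vs)).
Proof.
move=> li; apply: Rsup_lub.
  by have [v [sv nv]] := unit_vector_in_span li; exists (quad A v), v.
have [K [K0 HK]] := quad_bound A; exists K => q [v [_ [nv ->]]].
by have := HK v; rewrite nv; split_Rabs; lra.
Qed.

Let E A : R -> Prop := fun m => exists vs, lin_indep vs /\ m = Rsup (Q A vs).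

(** The infimum in [lambda] is finite: [j <= N] provides a coordinate subspace, and [1 <= j] a unit
    vector in each span, hence a lower bound. *)
Lemma E_lub A : is_lub (fun y => E A (- y)) (Rsup (fun y => E A (- y))).
Proof.
apply: Rsup_lub.
  have jN' : (j <= N)%N by case/andP: jN.
  pose vs (i : 'I_j) : vec N := ebasis (widen_ord jN' i).
  exists (- Rsup (Q A vs)), vs; split; last by ring.
  move=> c Hc i; have := Hc (widen_ord jN' i); rewrite -(sumR_delta c i) => <-.
  apply: sumR_ext => l; rewrite /vs /ebasis; congr (c l * (if _ then _ else _)).
  by rewrite -val_eqE /= eq_sym.
have [K [K0 HK]] := quad_bound A; exists K => y [vs [li Ey]].
have [v [sv nv]] := unit_vector_in_span li; have [ub _] := Q_lub A li.
have := ub _ (ex_intro _ v (conj sv (conj nv erefl))).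
move=> h1; have := HK v; have := Rle_abs (- quad A v); rewrite nv Rabs_Ropp; lra.
Qed.

Lemma elliptic_lambda : elliptic (@lambda N j).
Proof.
move=> A B c H.
have EL D : lambda j D = - Rsup (fun y => E D (- y)) by [].
rewrite !EL; suff : Rsup (fun y => E B (- y)) <= Rsup (fun y => E A (- y)) + c by lra.
have [ubA _] := E_lub A; have [_ lubB] := E_lub B; apply: lubB => y [vs [li Ey]].
have [_ lA] := Q_lub A li; have [uB _] := Q_lub B li.
have := ubA (- Rsup (Q A vs)) (ex_intro _ vs (conj li (Ropp_involutive _))) => H1.
suff : Rsup (Q A vs) <= Rsup (Q B vs) + c by lra.
apply: lA => q [v [sv [nv ->]]].
have := uB _ (ex_intro _ v (conj sv (conj nv erefl))); have := H v; rewrite nv; lra.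
Qed.

End Lambda.

(** * Quadratic polynomials as test functions *)

Section TestFunctions.
Variable N : nat.
Implicit Types (f z : vec N -> R) (a p x y : vec N) (A : mat N).

Definition C1_ucv (b b' : R -> R) : Prop :=
  [/\ forall t, derivable_pt_lim b t (b' t),
      forall T t, ucv T t -> ucv (fun n => b (T n)) (b t)
    & forall T t, ucv T t -> ucv (fun n => b' (T n)) (b' t)].

(** Test functions with separated variables, a function of time plus a quadratic polynomial in
    space, suffice for [decay_step]. *)
Definition parab_subj (F : mat N -> R) (Om : vec N -> Prop) (u : vec N -> R -> R) x t : Prop :=
  forall b b' p A r, C1_ucv b b' -> 0 < r ->
  (forall y s, Om y -> 0 < s -> near x r y -> Rabs (s - t) < r ->
     u y s <= u x t + (b s - b t) + dot p (vsub y x) + quad A (vsub y x) / 2) ->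
  b' t <= F A.

Lemma cont_st_ucv (f : vec N -> R -> R) :
  (forall X x T t, vcv X x -> ucv T t -> ucv (fun n => f (X n) (T n)) (f x t)) -> cont_st f.
Proof.
move=> H x t e e0; apply: NNPP => nd.
have step n : exists q : vec N * R, [/\ near x (/ (INR n + 1)) q.1, Rabs (q.2 - t) < / (INR n + 1)
    & e <= Rabs (f q.1 q.2 - f x t)].
  apply: NNPP => ny; apply: nd; exists (/ (INR n + 1)); split.
    by apply: Rinv_0_lt_compat; have := pos_INR n; lra.
  by move=> y s nxy st; apply: Rnot_le_lt => He; apply: ny; exists (y, s).
pose q n := epsilon (inhabits (x, t)) (fun q : vec N * R => [/\ near x (/ (INR n + 1)) q.1,
  Rabs (q.2 - t) < / (INR n + 1) & e <= Rabs (f q.1 q.2 - f x t)]).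
have Hq n : [/\ near x (/ (INR n + 1)) (q n).1, Rabs ((q n).2 - t) < / (INR n + 1)
    & e <= Rabs (f (q n).1 (q n).2 - f x t)] := epsilon_spec _ _ (step n).
have Hx : vcv (fun n => (q n).1) x.
  move=> i d d0; apply: om_mono (ucv_inv d0) _ => n; rewrite Rminus_0_r => Hd.
  by have [/(_ i) Hn _ _] := Hq n; have := Rle_abs (/ (INR n + 1)); lra.
have Ht : ucv (fun n => (q n).2) t.
  move=> d d0; apply: om_mono (ucv_inv d0) _ => n; rewrite Rminus_0_r => Hd.
  by have [_ Hn _] := Hq n; have := Rle_abs (/ (INR n + 1)); lra.
have [n Hn] := om_ex (H _ _ _ _ Hx Ht e e0).
by have [_ _ ?] := Hq n; lra.
Qed.

Lemma cont_x_st f : cont_st (fun y _ => f y) -> cont_x f.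
Proof.
move=> H x e e0; have [d [d0 Hd]] := H x 0 e e0; exists d; split=> // y ny.
by apply: (Hd y 0) => //; rewrite Rminus_diag Rabs_R0.
Qed.

Lemma derivable_poly2 (c0 c1 c2 : R) : derivable_pt_lim (fun s => c0 + s * c1 + s * s * c2) 0 c1.
Proof.
move=> e e0; have C : 0 < Rabs c2 + 1 by have := Rabs_pos c2; lra.
have d0 : 0 < e / (Rabs c2 + 1) by apply: Rdiv_lt_0_compat.
exists (mkposreal _ d0) => h h0 /= hd.
have -> : (c0 + (0 + h) * c1 + (0 + h) * (0 + h) * c2 - (c0 + 0 * c1 + 0 * 0 * c2)) / h - c1 = h * c2 by field.
rewrite Rabs_mult; have -> : e = e / (Rabs c2 + 1) * (Rabs c2 + 1) by field; lra.
have := Rabs_pos h; have := Rabs_pos c2; nra.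
Qed.

Definition qpoly (c : R) p A x y : R := c + dot p (vsub y x) + quad A (vsub y x) / 2.
Definition qpoly_grad p A x (i : 'I_N) y : R := p i + quadgrad A (vsub y x) i / 2.
(** The true Hessian of [quad A / 2]. It has the same quadratic form as [A], so ellipticity passes
    from one to the other. *)
Definition msym A : mat N := fun i k => (A i k + A k i) / 2.

Lemma quad_msym A x : quad (msym A) x = quad A x.
Proof.
have -> : quad (msym A) x = / 2 * (quad A x + quad A x).
  rewrite {2}/quad sumR_exchange /quad -sumR_plus -sumR_scal; apply: sumR_ext => i.
  by rewrite -sumR_plus -sumR_scal; apply: sumR_ext => k; rewrite /msym; field.
by field.
Qed.

Lemma vsub_rayl x t y a : vsub (ray x t y) a = ray (vsub x a) t y.
Proof. by apply: functional_extensionality => i; rewrite /vsub /ray; ring. Qed.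

Lemma qpoly_partial c p A x i y : has_partial (qpoly c p A x) y i (qpoly_grad p A x i y).
Proof.
rewrite /has_partial; have -> : (fun s => qpoly c p A x (fun k => y k + s * ebasis i k)) =
  (fun s => qpoly c p A x y + s * qpoly_grad p A x i y + s * s * (quad A (ebasis i) / 2)).
  apply: functional_extensionality => s; rewrite -/(ray y s (ebasis i)) /qpoly /qpoly_grad vsub_rayl.
  by rewrite quad_ray dot_ray !dot_ebasis; field.
exact: derivable_poly2.
Qed.

Lemma qpoly_partial2 p A x i k y : has_partial (qpoly_grad p A x i) y k (msym A i k).
Proof.
rewrite /has_partial; have -> : (fun s => qpoly_grad p A x i (fun k0 => y k0 + s * ebasis k k0)) =
  (fun s => qpoly_grad p A x i y + s * msym A i k + s * s * 0).
  apply: functional_extensionality => s; rewrite -/(ray y s (ebasis k)) /qpoly_grad vsub_rayl.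
  have -> : quadgrad A (ray (vsub y x) s (ebasis k)) i = quadgrad A (vsub y x) i + s * (A k i + A i k).
    have := dot_ray (fun l => A l i + A i l) (vsub y x) s (ebasis k).
    by rewrite dot_ebasis.
  by rewrite /msym; field.
exact: derivable_poly2.
Qed.

Lemma qpoly_ucv c p A x X y : vcv X y -> ucv (fun n => qpoly c p A x (X n)) (qpoly c p A x y).
Proof.
move=> H; have H1 := vcv_sub H (vcv_const x).
apply: ucv_plus; first by apply: ucv_plus; [exact: ucv_const|apply: ucv_dot => //; exact: vcv_const].
have := ucv_scal (/2) (ucv_quad A H1); rewrite (Rmult_comm (/2) (quad A _)).
by apply: ucv_eq; apply: om_all => n; rewrite Rmult_comm.
Qed.

Lemma qpoly_grad_ucv p A x i X y : vcv X y -> ucv (fun n => qpoly_grad p A x i (X n)) (qpoly_grad p A x i y).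
Proof.
move=> H; have H1 := vcv_sub H (vcv_const x).
apply: ucv_plus; first exact: ucv_const.
have := ucv_scal (/2) (ucv_dot (vcv_const (fun l => A l i + A i l)) H1); rewrite (Rmult_comm (/2) (dot _ _)).
by apply: ucv_eq; apply: om_all => n; rewrite Rmult_comm.
Qed.

Lemma qpoly_C2 c p A x : is_C2 (qpoly c p A x) (qpoly_grad p A x) (fun i k _ => msym A i k).
Proof.
split; first by move=> i y; apply: qpoly_partial.
split; first by move=> i k y; apply: qpoly_partial2.
split; first by apply: cont_x_st; apply: cont_st_ucv => X y T t HX _; apply: qpoly_ucv.
split=> [i|i k]; apply: cont_x_st; apply: cont_st_ucv => X y T t HX _; [exact: qpoly_grad_ucv|exact: ucv_const].
Qed.

Lemma qpoly_C21 c p A x b b' : C1_ucv b b' ->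
  is_C21 (fun y t => qpoly c p A x y + b t) (fun _ t => b' t)
         (fun i y _ => qpoly_grad p A x i y) (fun i k _ _ => msym A i k).
Proof.
move=> [Hd Hb Hb']; split.
  move=> y t; rewrite -(Rplus_0_l (b' t)).
  exact: derivable_pt_lim_plus (fun _ => qpoly c p A x y) b t 0 _ (derivable_pt_lim_const _ _) (Hd t).
split.
  move=> i y t; rewrite /has_partial -(Rplus_0_r (qpoly_grad p A x i y)).
  exact: (derivable_pt_lim_plus _ (fun _ => b t) 0 _ _ (qpoly_partial c p A x i y) (derivable_pt_lim_const _ _)).
split; first by move=> i k y t; apply: qpoly_partial2.
split; first by apply: cont_st_ucv => X y T t HX HT; apply: ucv_plus; [exact: qpoly_ucv|exact: Hb].
split; first by apply: cont_st_ucv => X y T t HX HT; apply: Hb'.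
by split=> [i|i k]; apply: cont_st_ucv => X y T t HX _; [exact: qpoly_grad_ucv|exact: ucv_const].
Qed.

Lemma C1_ucv_opp b b' : C1_ucv b b' -> C1_ucv (fun t => - b t) (fun t => - b' t).
Proof.
move=> [H1 H2 H3]; split; first by move=> t; apply: derivable_pt_lim_opp.
  by move=> T t HT; apply/ucv_opp/H2.
by move=> T t HT; apply/ucv_opp/H3.
Qed.

Lemma qpoly_self c p A x : qpoly c p A x x = c.
Proof. by rewrite /qpoly vsub_self dot_0r quad_0; field. Qed.

Lemma parab_visc_sub j Om g u0 u x t : (1 <= j <= N)%N -> parab_visc_sol j Om g u0 u ->
  Om x -> 0 < t -> parab_subj (@lambda N j) Om u x t.
Proof.
move=> jN [_ [_ [_ [_ Hab]]]] Ox t0 b b' p A r Hb r0 Ht.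
have := Hab x t Ox t0 _ _ _ _ (qpoly_C21 (u x t - b t) p A x Hb) => H.
have : b' t - lambda j (fun i k => msym A i k) <= 0.
  apply: H; split; first by rewrite /= qpoly_self; ring.
  exists r; split=> // y s Oy s0 ny st; have := Ht y s Oy s0 ny st; rewrite /qpoly; lra.
have : lambda j (msym A) <= lambda j A + 0.
  by apply: (elliptic_lambda jN) => v; rewrite quad_msym; lra.
rewrite -[fun i k => msym A i k]/(msym A); lra.
Qed.

Lemma parab_visc_sup j Om g u0 u x t : (1 <= j <= N)%N -> parab_visc_sol j Om g u0 u ->
  Om x -> 0 < t -> parab_subj (dualF (@lambda N j)) Om (fun y s => - u y s) x t.
Proof.
move=> jN [_ [_ [_ [Hbe _]]]] Ox t0 b b' p A r Hb r0 Ht.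
have := Hbe x t Ox t0 _ _ _ _ (qpoly_C21 (u x t + b t) (ray (vzero N) (-1) p) (mopp A) x (C1_ucv_opp Hb)) => H.
have : - b' t - lambda j (fun i k => msym (mopp A) i k) >= 0.
  apply: H; split; first by rewrite /= qpoly_self; ring.
  exists r; split=> // y s Oy s0 ny st; have := Ht y s Oy s0 ny st.
  rewrite /qpoly quad_mopp (dotC (ray _ _ _)) dot_ray0 (dotC _ p); lra.
have : lambda j (mopp A) <= lambda j (msym (mopp A)) + 0.
  by apply: (elliptic_lambda jN) => v; rewrite quad_msym; lra.
rewrite -[fun i k => msym (mopp A) i k]/(msym (mopp A)) /dualF; lra.
Qed.

Lemma ell_visc_sub j Om g z x : (1 <= j <= N)%N -> ell_visc_sol j Om g z ->
  Om x -> subj (@lambda N j) 0 Om z x.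
Proof.
move=> jN [_ [_ [_ Hab]]] Ox p A r r0 Ht.
have H := Hab x Ox _ _ _ (qpoly_C2 (z x) p A x) (qpoly_self _ _ _ _).
have : - lambda j (fun i k => msym A i k) <= 0 by apply: H; exists r.
have : lambda j (msym A) <= lambda j A + 0.
  by apply: (elliptic_lambda jN) => v; rewrite quad_msym; lra.
rewrite -[fun i k => msym A i k]/(msym A); lra.
Qed.

Lemma ell_visc_sup j Om g z x : (1 <= j <= N)%N -> ell_visc_sol j Om g z ->
  Om x -> subj (dualF (@lambda N j)) 0 Om (fun y => - z y) x.
Proof.
move=> jN [_ [_ [Hbe _]]] Ox p A r r0 Ht.
have H := Hbe x Ox _ _ _ (qpoly_C2 (z x) (ray (vzero N) (-1) p) (mopp A) x) (qpoly_self _ _ _ _).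
have : - lambda j (fun i k => msym (mopp A) i k) >= 0.
  apply: H; exists r; split=> // y Oy ny; have := Ht y Oy ny.
  rewrite /qpoly quad_mopp (dotC (ray _ _ _)) dot_ray0 (dotC _ p); lra.
have : lambda j (mopp A) <= lambda j (msym (mopp A)) + 0.
  by apply: (elliptic_lambda jN) => v; rewrite quad_msym; lra.
rewrite -[fun i k => msym (mopp A) i k]/(msym (mopp A)) /dualF; lra.
Qed.

End TestFunctions.

(** * Exponential decay *)

Lemma ucv_pow a l k : ucv a l -> ucv (fun n => a n ^ k) (l ^ k).
Proof. by move=> H; elim: k => [|k IH] /=; [exact: ucv_const|exact: ucv_mult]. Qed.

Lemma affine_power_C1_ucv (nu kap s T : R) (k : nat) :
  C1_ucv (fun t => - nu * (t - s) + kap * ((t - s) / T) ^ k.+1)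
         (fun t => - nu + kap * (INR k.+1 * ((t - s) / T) ^ k * / T)).
Proof.
have Haff Tn t : ucv Tn t -> ucv (fun n => (Tn n - s) / T) ((t - s) / T).
  by move=> H; apply: ucv_mult (ucv_const _); apply: ucv_minus (ucv_const _).
split.
- move=> t.
  have Ht : derivable_pt_lim (fun t => t - s) t 1.
    rewrite -(Rminus_0_r 1).
    exact: (derivable_pt_lim_minus id (fun _ => s) t 1 0 (derivable_pt_lim_id t) (derivable_pt_lim_const s t)).
  have Hd : derivable_pt_lim (fun t => (t - s) / T) t (/ T).
    have := derivable_pt_lim_scal (fun t => t - s) (/ T) t 1 Ht; rewrite Rmult_1_r.
    by rewrite (_ : mult_real_fct (/ T) (fun t => t - s) = (fun t => (t - s) / T)) //;
      apply: functional_extensionality => y; rewrite /mult_real_fct /Rdiv; ring.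
  have Hp := derivable_pt_lim_comp _ (fun y => y ^ k.+1) t _ _ Hd (derivable_pt_lim_pow ((t - s) / T) k.+1).
  have H1 := derivable_pt_lim_scal _ (- nu) t _ Ht; rewrite Rmult_1_r in H1.
  exact: derivable_pt_lim_plus H1 (derivable_pt_lim_scal _ kap t _ Hp).
- move=> Tn t H; apply: ucv_plus; last by apply/ucv_scal/ucv_pow/Haff.
  by apply: ucv_scal; apply: ucv_minus (ucv_const _).
- move=> Tn t H; apply: ucv_plus; first exact: ucv_const.
  by apply: ucv_scal; apply: ucv_mult (ucv_const _); apply: ucv_scal; apply/ucv_pow/Haff.
Qed.

Section Decay.
Variable N : nat.
Implicit Types (x y : vec N).

(** * Compactness in space and time *)

Lemma cont_on_cyl_ucv Om (u : vec N -> R -> R) X x T t : cont_on_cyl Om u -> closure Om x -> 0 <= t ->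
  om (fun n => closure Om (X n) /\ 0 <= T n) -> vcv X x -> ucv T t ->
  ucv (fun n => u (X n) (T n)) (u x t).
Proof.
move=> Hu Cx t0 HC HX HT e e0; have [d [d0 Hd]] := Hu x t Cx t0 e e0.
by apply: om_mono3 HC (vcv_near HX d0) (HT d d0) _ => n [? ?] ? ?; apply: Hd.
Qed.

Lemma cyl_bounded Om (u : vec N -> R -> R) s T : is_bounded Om -> cont_on_cyl Om u -> 0 <= s -> 0 <= T ->
  exists B, 0 <= B /\ forall x t, closure Om x -> 0 <= t <= T -> Rabs (u x (s + t)) <= B.
Proof.
move=> bO Hu s0 T0; have [M [M0 HM]] := closure_bounded bO.
apply: NNPP => nB.
have step n : exists q : vec N * R, [/\ closure Om q.1, 0 <= q.2 <= T & INR n < Rabs (u q.1 (s + q.2))].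
  apply: NNPP => nq; apply: nB; exists (INR n); split; first exact: pos_INR.
  by move=> x t Cx Ht; apply: Rnot_lt_le => Hlt; apply: nq; exists (x, t).
pose q n := epsilon (inhabits (vzero N, 0)) (fun q : vec N * R =>
  [/\ closure Om q.1, 0 <= q.2 <= T & INR n < Rabs (u q.1 (s + q.2))]).
have Hq n : [/\ closure Om (q n).1, 0 <= (q n).2 <= T & INR n < Rabs (u (q n).1 (s + (q n).2))] :=
  epsilon_spec _ _ (step n).
have C1 : om (fun n => closure Om (q n).1) by apply: om_all => n; case: (Hq n).
have [x Hx] : exists x, vcv (fun n => (q n).1) x.
  by apply: (@vcv_bounded _ _ M); apply: om_mono C1 _ => n; apply: HM.
have [t Ht] : exists t, ucv (fun n => (q n).2) t.
  by apply: (@ucv_exists _ T); apply: om_all => n; have [_ ? _] := Hq n; split_Rabs; lra.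
have t0 : 0 <= t by apply: ucv_le _ (ucv_const 0) Ht; apply: om_all => n; have [_ ? _] := Hq n; lra.
have H := cont_on_cyl_ucv Hu (closure_vcv C1 Hx) (t := s + t) (T := fun n => s + (q n).2) ltac:(lra) _ Hx (ucv_plus (ucv_const s) Ht).
have {}H : ucv (fun n => u (q n).1 (s + (q n).2)) (u x (s + t)).
  by apply: H; apply: om_mono C1 _ => n; have [_ ? _] := Hq n; split=> //; lra.
have [k Hk] := INR_unbounded (Rabs (u x (s + t)) + 1).
have [n [/leP /le_INR ? ?]] := om_ex (om_and (om_ge k) (ucv_bounded H)).
by have [_ _ ?] := Hq n; lra.
Qed.

(** Continuity of the maximum: by compactness of the time interval, maximal times have a limit,
    which is maximal at the limit point. *)
Lemma max_in_time Om (g : vec N -> R -> R) T B : 0 <= T ->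
  (forall x t, closure Om x -> 0 <= t <= T -> Rabs (g x t) <= B) ->
  (forall X x Tn t, om (fun n => closure Om (X n) /\ 0 <= Tn n <= T) -> closure Om x -> 0 <= t <= T ->
     vcv X x -> ucv Tn t -> ucv (fun n => g (X n) (Tn n)) (g x t)) ->
  exists f, cont_on (closure Om) f /\ forall x, closure Om x ->
    (exists t, 0 <= t <= T /\ f x = g x t) /\ forall t, 0 <= t <= T -> g x t <= f x.
Proof.
move=> T0 bg Hg.
have am x : closure Om x -> exists t, 0 <= t <= T /\ forall t', 0 <= t' <= T -> g x t' <= g x t.
  (* Times are treated as one-dimensional vectors, so that [argmax] applies. *)
  move=> Cx; pose S (w : vec 1) := 0 <= w ord0 <= T.
  have [||||w [Sw Hw]] := @argmax 1 S (fun w => g x (w ord0)) (vzero 1) (T * T).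
  - by rewrite /S /vzero; lra.
  - by move=> w Sw _; rewrite /norm2 /sumR big_ord1; move: Sw; rewrite /S; nra.
  - move=> W w SW _ HW; split.
      by apply: ucv_le _ (ucv_const 0) (HW ord0); apply: om_all => n; case: (SW n).
    by apply: ucv_le _ (HW ord0) (ucv_const T); apply: om_all => n; case: (SW n).
  - move=> w Sw W SW HW e e0; have := Hg (fun _ => x) x (fun n => W n ord0) (w ord0) (om_all (fun n => conj Cx (SW n))) Cx Sw (vcv_const x) (HW ord0).
    by move=> /ucv_lt; apply; lra.
  - by exists (w ord0); split=> // t' Ht'; apply: (Hw (fun _ => t')).
pose tm x := epsilon (inhabits 0) (fun t => 0 <= t <= T /\ forall t', 0 <= t' <= T -> g x t' <= g x t).
have Htm x (Cx : closure Om x) : 0 <= tm x <= T /\ forall t', 0 <= t' <= T -> g x t' <= g x (tm x) := epsilon_spec _ _ (am x Cx).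
exists (fun x => g x (tm x)); split; last first.
  by move=> x Cx; have [H1 H2] := Htm x Cx; split=> //; exists (tm x).
apply: vcv_cont_on => X x CX Cx HX.
have [l Hl] : exists l, ucv (fun n => g (X n) (tm (X n))) l.
  by apply: (@ucv_exists _ B); apply: om_all => n; apply: bg => //; case: (Htm _ (CX n)).
have [t Ht] : exists t, ucv (fun n => tm (X n)) t.
  by apply: (@ucv_exists _ T); apply: om_all => n; have [? _] := Htm _ (CX n); split_Rabs; lra.
have tT : 0 <= t <= T.
  by split; [apply: ucv_le _ (ucv_const 0) Ht|apply: ucv_le _ Ht (ucv_const T)]; apply: om_all => n; have [? _] := Htm _ (CX n); lra.
suff -> : g x (tm x) = l by [].
have [tx mx] := Htm x Cx.
apply: Rle_antisym.
  have H := Hg X x (fun _ => tm x) (tm x) (om_all (fun n => conj (CX n) tx)) Cx tx HX (ucv_const _).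
  by apply: ucv_le _ H Hl; apply: om_all => n; have [_ H2] := Htm _ (CX n); apply: H2.
have H := Hg X x (fun n => tm (X n)) t (om_all (fun n => conj (CX n) (proj1 (Htm _ (CX n))))) Cx tT HX Ht.
by rewrite (ucv_unique Hl H); apply: mx.
Qed.

(* Compare with [z] the function [f - b], where [f x] is the maximum over
   [t <= 3Q] of [u x (s + t) + nu t - kap (t / T)^k] and
   [b x = 2M - nu |x|^2].  The power of [t] keeps the maximum away from the final
   time, and [nu] is chosen so that the time slope [-nu] is beaten by the shift
   [2 nu] of the Hessian coming from [b]. *)
Lemma decay_step Om (F : mat N -> R) (u : vec N -> R -> R) (z : vec N -> R) (Q M s : R) :
  (0 < N)%N -> is_open Om -> is_bounded Om -> elliptic F ->
  0 < Q -> (forall x, closure Om x -> norm2 x <= Q) -> 0 < M -> 0 <= s ->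
  cont_on_cyl Om u -> cont_on (closure Om) z ->
  (forall x t, boundary Om x -> 0 <= t -> u x t = z x) ->
  (forall x t, Om x -> 0 < t -> parab_subj F Om u x t) ->
  (forall x, Om x -> subj (dualF F) 0 Om (fun y => - z y) x) ->
  (forall x, Om x -> u x s <= z x + M) ->
  forall x t, Om x -> 0 <= t <= 5 / 2 * Q -> u x (s + t) <= z x + 17 / 8 * M - M / (2 * Q) * t.
Proof.
move=> N0 oO bO HF Q0 HQ M0 s0 Hu Hz bnd sub sup init.
(* This makes [nu |x|^2 <= M / 2], so the barrier stays between [3M/2] and [2M]. *)
pose nu := M / (2 * Q); have nu0 : 0 < nu by apply: Rdiv_lt_0_compat; lra.
have nuQ : nu * Q = M / 2 by rewrite /nu; field; lra.
(* [nu T1 = 3M/2] is the least value of the barrier, which settles the boundary. As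
   [T1 / T = 6/5 > 1], a high power makes the penalty prohibitive at [T1], while it costs at most
   [M / 8] up to [T]. *)
pose T := 5 / 2 * Q; pose T1 := 3 * Q; pose kap := M / 8.
have Tp : 0 < T by rewrite /T; lra.
have iT : 0 < / T by apply: Rinv_0_lt_compat.
have T10 : 0 <= T1 by rewrite /T1; lra.
have [B [B0 HB]] := cyl_bounded bO Hu s0 T10.
have [k Hk] : exists k, 2 * B + nu * T1 + 1 <= kap * (6 / 5) ^ k.+1.
  have [k Hk] := Pow_x_infinity (6 / 5) ltac:(rewrite Rabs_pos_eq; lra) ((2 * B + nu * T1 + 1) / kap).
  exists k; have := Hk k.+1 ltac:(lia); rewrite Rabs_pos_eq; last by apply: pow_le; lra.
  move=> /Rge_le /(Rmult_le_compat_l kap _ _ ltac:(rewrite /kap; lra)).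
  by have -> : kap * ((2 * B + nu * T1 + 1) / kap) = 2 * B + nu * T1 + 1 by field; rewrite /kap; lra.
pose b t := - nu * (t - s) + kap * ((t - s) / T) ^ k.+1.
pose b' t := - nu + kap * (INR k.+1 * ((t - s) / T) ^ k * / T).
have Hb : C1_ucv b b' := affine_power_C1_ucv nu kap s T k.
pose g x t := u x (s + t) - b (s + t).
have bE t : b (s + t) = - nu * t + kap * (t / T) ^ k.+1.
  by rewrite /b; have -> : s + t - s = t by ring.
have pw t : 0 <= t -> 0 <= (t / T) ^ k.+1.
  by move=> t0; apply: pow_le; apply: Rmult_le_pos; lra.
have kap0 : 0 < kap by rewrite /kap; lra.
have [f [cf Hf]] : exists f, cont_on (closure Om) f /\ forall x, closure Om x ->
    (exists t, 0 <= t <= T1 /\ f x = g x t) /\ forall t, 0 <= t <= T1 -> g x t <= f x.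
  apply: (@max_in_time Om g T1 (B + nu * T1 + kap * (T1 / T) ^ k.+1)) => //.
    move=> x t Cx tT; have := HB x t Cx tT; rewrite /g bE.
    have h1 : 0 <= nu * t <= nu * T1 by split; nra.
    have h2 : 0 <= kap * (t / T) ^ k.+1 <= kap * (T1 / T) ^ k.+1.
      split; first by apply: Rmult_le_pos; [lra|apply: pw; lra].
      apply: Rmult_le_compat_l; first lra.
      by apply: pow_incr; split; [apply: Rmult_le_pos; lra|apply: Rmult_le_compat_r; lra].
    by split_Rabs; lra.
  move=> X x Tn t HC Cx tT HX HT; apply: ucv_minus.
    apply: (cont_on_cyl_ucv Hu Cx) => //; first lra.
      by apply: om_mono HC _ => n [? ?]; split=> //; lra.
    exact: ucv_plus (ucv_const s) HT.
  by have [_ H _] := Hb; apply: H; apply: ucv_plus (ucv_const s) HT.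
pose bar x := 2 * M - nu * norm2 x.
have barb x : closure Om x -> 3 / 2 * M <= bar x <= 2 * M.
  by move=> /HQ h; have := norm2_ge0 x; rewrite /bar; nra.
have key : forall x, Om x -> f x - bar x <= z x.
  apply: (@comparison N Om F nu (fun x => f x - bar x) z) => //.
  - apply: vcv_cont_on => X x CX Cx HX; apply: ucv_minus.
      exact: cont_on_ucv cf Cx (om_all CX) HX.
    by apply: ucv_minus; [exact: ucv_const|apply/ucv_scal/ucv_norm2].
  - move=> x bx; have Cx : closure Om x by case: bx.
    have [[t [tT ->]] _] := Hf x Cx; rewrite /g bnd //; last lra.
    have := barb x Cx; have := pw t ltac:(lra); rewrite bE.
    have : nu * t <= nu * T1 by nra.
    have : nu * T1 = 3 / 2 * M by rewrite /T1; lra.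
    by move=> h1 h2 h3 h4; have := Rmult_le_pos _ _ (Rlt_le _ _ kap0) h3; lra.
  (* The maximal time is interior: at 0 the initial bound [M] is below the barrier, and at [T1] the
     penalty loses against time 0. *)
  - move=> x Ox fz; have Cx := subset_closure Ox.
    have [[t [tT Et]] mx] := Hf x Cx.
    have t0 : 0 < t.
      apply: Rnot_le_lt => t0; have E0 : t = 0 by lra.
      move: fz; rewrite Et E0 /g bE Rplus_0_r /Rdiv Rmult_0_l pow_i; last lia.
      by have := init x Ox; have := barb x Cx; lra.
    have t1 : t < T1.
      apply: Rnot_le_lt => t1; have E1 : t = T1 by lra.
      have := mx 0 ltac:(lra); rewrite Et E1 /g !bE; have -> : 0 / T = 0 by rewrite /Rdiv Rmult_0_l.
      rewrite pow_i; last lia.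
      have -> : T1 / T = 6 / 5 by rewrite /T1 /T; field; lra.
      have := HB x 0 Cx ltac:(lra); have := HB x T1 Cx ltac:(lra).
      by split_Rabs; lra.
    move=> p A r r0 Ht.
    (* The Hessian of the test function once the barrier is moved to the side of [f]. With the time
       slope at least [- nu] one gets [- nu <= F A' <= F A - 2 nu]. *)
    pose A' := madd A (mscal (- 2 * nu)).
    have qA' v : quad A' v = quad A v - 2 * nu * norm2 v by rewrite quad_madd quad_mscal; ring.
    have : b' (s + t) <= F A'.
      apply: (sub x (s + t) Ox ltac:(lra) b b' (ray p (- 2 * nu) x) A' (Rmin r (Rmin t (T1 - t)))) => //.
        by apply: Rmin_pos => //; apply: Rmin_pos; lra.
      move=> y t' Oy _ ny nt.
      have := Rmin_l r (Rmin t (T1 - t)); have := Rmin_r r (Rmin t (T1 - t)).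
      have := Rmin_l t (T1 - t); have := Rmin_r t (T1 - t) => m1 m2 m3 m4.
      have ny' : near x r y by move=> i; have := ny i; lra.
      have tT' : 0 <= t' - s <= T1 by move: nt; split_Rabs; lra.
      have [_ my] := Hf y (subset_closure Oy).
      have := my (t' - s) tT'; have := Ht y Oy ny'; rewrite Et /g /bar.
      have -> : s + (t' - s) = t' by ring.
      rewrite qA' dot_rayl norm2_sub (dot_sub x) (dotC y x) dot_norm2; lra.
    have : - nu <= b' (s + t).
      rewrite /b'; have -> : s + t - s = t by ring.
      have : 0 <= kap * (INR k.+1 * (t / T) ^ k * / T); last lra.
      apply: Rmult_le_pos; first lra; apply: Rmult_le_pos; last lra.
      apply: Rmult_le_pos; first exact: pos_INR.
      by apply: pow_le; apply: Rmult_le_pos; lra.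
    have : F A' <= F A + - (2 * nu) by apply: HF => v; rewrite qA'; lra.
    lra.
move=> x t Ox tT; have Cx := subset_closure Ox.
have [_ mx] := Hf x Cx; have := mx t ltac:(rewrite /T1; lra); have := key x Ox; have := barb x Cx.
rewrite /g bE -/nu.
have : (t / T) ^ k.+1 <= 1.
  rewrite -(pow1 k.+1); apply: pow_incr; split; first by apply: Rmult_le_pos; lra.
  by apply: (Rmult_le_reg_r T) => //; rewrite /Rdiv Rmult_assoc Rinv_l; rewrite /T in tT *; lra.
by move=> h1 h2 h3 h4; have : kap * (t / T) ^ k.+1 <= M / 8; [rewrite /kap; nra|lra].
Qed.

(** At the end of a step of length [5Q/2] the bound is [17/8 - 5/4 = 7/8] of the initial one. Since
    [7/8 <= exp (-1/8)], the rate is [1/8] divided by [5Q/2]. Inside a step the factor [17/8] is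
    below [3] times [7/8]. *)
Lemma exp_decay_bound Om (F : mat N -> R) (u : vec N -> R -> R) (z : vec N -> R) (Q M : R) :
  (0 < N)%N -> is_open Om -> is_bounded Om -> elliptic F ->
  0 < Q -> (forall x, closure Om x -> norm2 x <= Q) -> 0 < M ->
  cont_on_cyl Om u -> cont_on (closure Om) z ->
  (forall x t, boundary Om x -> 0 <= t -> u x t = z x) ->
  (forall x t, Om x -> 0 < t -> parab_subj F Om u x t) ->
  (forall x, Om x -> subj (dualF F) 0 Om (fun y => - z y) x) ->
  (forall x, Om x -> u x 0 <= z x + M) ->
  forall x t, Om x -> 0 < t -> u x t - z x <= 3 * M * exp (- (/ (20 * Q)) * t).
Proof.
move=> N0 oO bO HF Q0 HQ M0 Hu Hz bnd sub sup init.
pose T := 5 / 2 * Q; have Tp : 0 < T by rewrite /T; lra.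
have step s M' := @decay_step Om F u z Q M' s N0 oO bO HF Q0 HQ.
have it n : forall x, Om x -> u x (INR n * T) <= z x + (7 / 8) ^ n * M.
  elim: n => [|n IH] x Ox; first by rewrite Rmult_0_l Rmult_1_l; apply: init.
  have p0 : 0 < (7 / 8) ^ n * M by apply: Rmult_lt_0_compat => //; apply: pow_lt; lra.
  have nT : 0 <= INR n * T by apply: Rmult_le_pos; [exact: pos_INR|lra].
  have := step (INR n * T) _ p0 nT Hu Hz bnd sub sup IH x T Ox ltac:(rewrite /T; lra).
  have -> : INR n.+1 * T = INR n * T + T by rewrite S_INR; ring.
  have -> : (7 / 8) ^ n.+1 * M = 7 / 8 * ((7 / 8) ^ n * M) by rewrite /=; ring.
  have -> : (7 / 8) ^ n * M / (2 * Q) * T = 5 / 4 * ((7 / 8) ^ n * M) by rewrite /T; field; lra.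
  lra.
move=> x t Ox t0.
have [n [n1 n2]] : exists n, INR n * T <= t < INR n.+1 * T.
  have [k Hk] := INR_unbounded (t / T).
  have tk : t < INR k * T.
    by have := Rmult_lt_compat_r T _ _ Tp Hk; have -> : t / T * T = t by field; lra.
  have [i Hi] := @subinterval k t T Tp (conj (Rlt_le _ _ t0) tk).
  by exists i; rewrite S_INR; lra.
have p0 : 0 < (7 / 8) ^ n * M by apply: Rmult_lt_0_compat => //; apply: pow_lt; lra.
have nT : 0 <= INR n * T by apply: Rmult_le_pos; [exact: pos_INR|lra].
have := step (INR n * T) _ p0 nT Hu Hz bnd sub sup (it n) x (t - INR n * T) Ox.
have -> : INR n * T + (t - INR n * T) = t by ring.
move: n2; rewrite S_INR => n2; move=> /(_ ltac:(rewrite -/T; lra)) H1.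
have H2 : 0 <= (7 / 8) ^ n * M / (2 * Q) * (t - INR n * T).
  by apply: Rmult_le_pos; [left; apply: Rdiv_lt_0_compat; lra|lra].
have e1 : 7 / 8 <= exp (- / 8) by have := exp_ineq1_le (- / 8); lra.
have en m : (7 / 8) ^ m <= exp (INR m * - / 8).
  elim: m => [|m IH]; first by rewrite Rmult_0_l exp_0 /=; lra.
  rewrite S_INR Rmult_plus_distr_r Rmult_1_l exp_plus /=.
  have := pow_lt (7 / 8) m ltac:(lra) => pm.
  by rewrite Rmult_comm; apply: Rmult_le_compat; lra.
have H3 : (7 / 8) ^ n.+1 <= exp (- / (20 * Q) * t).
  apply: Rle_trans (en n.+1) _.
  have h : INR n.+1 * - / 8 <= - / (20 * Q) * t.
    rewrite S_INR; have -> : t = T * (t / T) by field; lra.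
    have -> : - / (20 * Q) * (T * (t / T)) = - / 8 * (t / T) by rewrite /T; field; lra.
    suff : t / T <= INR n + 1 by lra.
    by apply: (Rmult_le_reg_r T) => //; rewrite /Rdiv Rmult_assoc Rinv_l; lra.
  by case: h => [h|->]; [left; apply: exp_increasing|lra].
have : (7 / 8) ^ n.+1 * M <= exp (- / (20 * Q) * t) * M by apply: Rmult_le_compat_r; lra.
rewrite [(7 / 8) ^ n.+1]/=; lra.
Qed.

(** The definition fixes [u] on the boundary for positive times and at time 0 only inside;
    continuity supplies the corner, where [decay_step] also needs [u = z]. *)
Lemma initial_data_closure Om u0 (u : vec N -> R -> R) : cont_on_cyl Om u -> cont_on (closure Om) u0 ->
  (forall x, Om x -> u x 0 = u0 x) -> forall x, closure Om x -> u x 0 = u0 x.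
Proof.
move=> Hu Hu0 init x Cx.
have step n : exists y, Om y /\ near x (/ (INR n + 1)) y.
  by apply: Cx; apply: Rinv_0_lt_compat; have := pos_INR n; lra.
pose X n := epsilon (inhabits x) (fun y => Om y /\ near x (/ (INR n + 1)) y).
have HX n : Om (X n) /\ near x (/ (INR n + 1)) (X n) := epsilon_spec _ _ (step n).
have Xx : vcv X x.
  move=> i d d0; apply: om_mono (ucv_inv d0) _ => n; rewrite Rminus_0_r => Hd.
  by have [_ /(_ i) Hn] := HX n; have := Rle_abs (/ (INR n + 1)); lra.
have CX n : closure Om (X n) by apply: subset_closure; case: (HX n).
have H1 := cont_on_cyl_ucv Hu Cx (Rle_refl 0) (om_all (fun n => conj (CX n) (Rle_refl 0))) Xx (ucv_const 0).
have H2 := cont_on_ucv Hu0 Cx (om_all CX) Xx.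
by apply: (ucv_unique H1); apply: ucv_eq H2; apply: om_all => n; rewrite init //; case: (HX n).
Qed.

End Decay.

Theorem theorem1p2 (N : nat) (Om : vec N -> Prop) (Hom : is_bounded_domain Om) :
  exists mu : R, (0 < mu)%R /\
  forall (j : nat) (u0 : vec N -> R) (u : vec N -> R -> R) (z : vec N -> R),
    (1 <= j <= N)%N ->
    cont_on (closure Om) u0 ->
    parab_visc_sol j Om u0 u0 u ->
    ell_visc_sol j Om u0 z ->
    exists C : R, (0 < C)%R /\
      forall (t : R) (x : vec N), (0 < t)%R -> Om x ->
        (Rabs (u x t - z x) <= C * exp (- mu * t))%R.
Proof.
have [_ [oO [_ bO]]] := Hom.
have [M1 [M10 HM1]] := closure_bounded bO.
pose Q := M1 + 1; have Q0 : 0 < Q by rewrite /Q; lra.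
have HQ x : closure Om x -> norm2 x <= Q by move=> /HM1; rewrite /Q; lra.
exists (/ (20 * Q)); split; first by apply: Rinv_0_lt_compat; lra.
move=> j u0 u z jN Hu0 Hu Hz.
have N0 : (0 < N)%N by case/andP: jN => j0; apply: leq_trans.
have [cu [bu [iu _]]] := Hu; have [cz [bz _]] := Hz.
have iu' := initial_data_closure cu Hu0 iu.
have bnd x t : boundary Om x -> 0 <= t -> u x t = z x.
  by move=> bx [t0|<-]; rewrite bz //; [apply: bu|apply: iu'; case: bx].
have [B0 [B00 HB0]] := bounded_on_closure bO Hu0.
have [Bz [Bz0 HBz]] := bounded_on_closure bO cz.
pose M := B0 + Bz + 1; have M0 : 0 < M by rewrite /M; lra.
have HM x : Om x -> Rabs (u x 0 - z x) <= M.
  move=> Ox; rewrite iu //; have := HB0 x (subset_closure Ox); have := HBz x (subset_closure Ox).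
  by rewrite /M; split_Rabs; lra.
have HF := elliptic_lambda jN.
exists (3 * M); split; first lra.
move=> t x t0 Ox.
have up : u x t - z x <= 3 * M * exp (- (/ (20 * Q)) * t).
  apply: (exp_decay_bound N0 oO bO HF Q0 HQ M0 cu cz bnd) => //.
  - by move=> y s Oy s0; apply: parab_visc_sub Hu Oy s0.
  - by move=> y Oy; apply: ell_visc_sup Hz Oy.
  - by move=> y Oy; have := HM y Oy; split_Rabs; lra.
(* The same estimate for [- u] and [- z] with the dual operator, whose own dual agrees with
   [lambda j] by ellipticity. *)
have lo : - u x t - - z x <= 3 * M * exp (- (/ (20 * Q)) * t).
  apply: (exp_decay_bound (u := fun y s => - u y s) (z := fun y => - z y) N0 oO bO (elliptic_dual HF) Q0 HQ M0) => //.
  - move=> y s Cy s0 e e0; have [d [d0 Hd]] := cu y s Cy s0 e e0; exists d; split=> // y' s' Cy' s0' ny ns.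
    by have := Hd y' s' Cy' s0' ny ns; split_Rabs; lra.
  - move=> y Cy e e0; have [d [d0 Hd]] := cz y Cy e e0; exists d; split=> // y' Cy' ny.
    by have := Hd y' Cy' ny; split_Rabs; lra.
  - by move=> y s By s0; rewrite bnd.
  - by move=> y s Oy s0; apply: parab_visc_sup Hu Oy s0.
  - move=> y Oy p A r r0 Ht.
    have HA : 0 <= lambda j A.
      by apply: (ell_visc_sub jN Hz Oy (p := p) r0) => y' Oy' ny; have := Ht y' Oy' ny; lra.
    have : lambda j A <= lambda j (mopp (mopp A)) + 0 by apply: HF => v; rewrite !quad_mopp; lra.
    by rewrite /dualF; lra.
  - by move=> y Oy; have := HM y Oy; split_Rabs; lra.
by split_Rabs; lra.
Qed.
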